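(* Let $R=k[x_1,\ldots,x_r]$ be a polynomial ring over a field $k$ and let $>$ be a monomial order on the monomials in $x_1,\ldots,x_r$ that respects total degree. Let $I\subseteq R$ be a square-free monomial ideal of codimension $2$ such that $R/I$ is Cohen-Macaulay and such that the minimal generators of $I$ all have the same degree. Then there exist an extension field $K$ of $k$ and a prime ideal $P$ of the polynomial ring $S=K[x_1,\ldots,x_r]$ such that $\mathrm{in}(P)=IS$, where $\mathrm{in}(P)$ is the initial ideal of $P$ with respect to $>$.
   Context: A monomial order on a polynomial ring is a total order $\geq$ on its monomials such that $m\ge 1$ for every monomial $m$, and $m_1\geq m_2$ implies $nm_1\ge nm_2$ for all monomials $m_1,m_2,n$. It respects total degree if $\deg m_1>\deg m_2$ implies $m_1>m_2$. The same order $>$ is used on the monomials of $S=K[x_1,\ldots,x_r]$. For a nonzero polynomial $f$, $\mathrm{in}(f)$ is the largest term of $f$ (including its coefficient), and $\mathrm{in}(P)=\langle \mathrm{in}(f): f\in P,\ f\ne 0\rangle$. *)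

(* Defs.v *)
From HB Require Import structures.
From mathcomp Require Import all_boot all_order all_algebra.
From mathcomp Require Import mpoly.

Set Implicit Arguments.
Unset Strict Implicit.
Unset Printing Implicit Defensive.

Import GRing.Theory.

Local Open Scope ring_scope.

(* Ideals are MathComp's [idealr] and [prime_idealr]: boolean predicates, and
   always proper.  Sets of generators and the ideals they generate are
   Prop-valued, as they may be the whole ring and need not be decidable. *)

Section CommutativeAlgebra.
Variable A : comNzRingType.

Definition ideal_gen (G : A -> Prop) (x : A) : Prop :=
  exists2 s : seq (A * A),
    forall p, p \in s -> G p.2 & x = \sum_(p <- s) p.1 * p.2.

Definition noetherian : Prop :=
  forall J : idealr A, exists s : seq A,
    forall x, x \in J <-> ideal_gen (fun y => y \in s) x.

Definition prime_chain (P : prime_idealr A) (n : nat) : Prop :=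
  exists2 c : nat -> prime_idealr A,
    c n =i P &
    forall i, (i < n)%N ->
      {subset c i <= c i.+1} /\ ~ {subset c i.+1 <= c i}.

Definition height (P : prime_idealr A) (n : nat) : Prop :=
  prime_chain P n /\ forall m, prime_chain P m -> (m <= n)%N.

(* The codimension of an ideal is the least height of a prime containing it. *)
Definition codim (J : idealr A) (n : nat) : Prop :=
  (exists2 P : prime_idealr A, {subset J <= P} & height P n) /\
  (forall (P : prime_idealr A) m,
     {subset J <= P} -> height P m -> (n <= m)%N).

Definition regular_sequence (s : seq A) : Prop :=
  ~ ideal_gen (fun y => y \in s) 1 /\
  forall i, (i < size s)%N -> forall x,
    ideal_gen (fun y => y \in take i s) (s`_i * x) ->
    ideal_gen (fun y => y \in take i s) x.

Definition depth (J : idealr A) (d : nat) : Prop :=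
  (exists s, [/\ regular_sequence s, {subset s <= J} & size s = d]) /\
  (forall s, regular_sequence s -> {subset s <= J} -> (size s <= d)%N).

Definition maximal_ideal (M : idealr A) : Prop :=
  forall J : idealr A, {subset M <= J} -> {subset J <= M}.

(* Eisenbud's definition: A is noetherian and depth M = codim M for every
   maximal ideal M.  Quantifying over prime M loses nothing, and for those the
   codimension is the height. *)
Definition cohen_macaulay : Prop :=
  noetherian /\
  forall M : prime_idealr A, maximal_ideal M ->
    exists2 d, depth M d & height M d.

End CommutativeAlgebra.

Section MonomialIdeals.
Variables (k : fieldType) (r : nat).
Implicit Types (I : idealr {mpoly k[r]}) (B : 'X_{1..r} -> Prop).

Definition monomial_generators B I : Prop :=
  forall f, f \in I <->
    ideal_gen (fun g : {mpoly k[r]} => exists2 m, B m & g = 'X_[m]) f.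

Definition squarefree_monomial_ideal I : Prop :=
  exists2 B, forall m, B m -> forall i, (m i <= 1)%N &
    monomial_generators B I.

Definition minimal_monomial_generators B I : Prop :=
  monomial_generators B I /\
  forall B', (forall m, B' m -> B m) -> monomial_generators B' I ->
    forall m, B m -> B' m.

Definition equigenerated I : Prop :=
  exists d, forall B, minimal_monomial_generators B I ->
    forall m, B m -> mdeg m = d.

End MonomialIdeals.

Section MonomialOrders.
Variable r : nat.
Variable ge : rel 'X_{1..r}.  (* [ge m1 m2] stands for m1 >= m2 *)

Definition monomial_order : Prop :=
  [/\ total ge, antisymmetric ge, transitive ge,
      forall m, ge m 0%MM &
      forall m1 m2 n, ge m1 m2 -> ge (n + m1)%MM (n + m2)%MM].

Definition respects_degree : Prop :=
  forall m1 m2, (mdeg m1 > mdeg m2)%N -> ge m1 m2 && (m1 != m2).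

Section InitialIdeal.
Variable K : fieldType.

(* Only a nonzero f has an initial term. *)
Definition is_initial_term (f t : {mpoly K[r]}) : Prop :=
  exists m, [/\ m \in msupp f,
                forall m', m' \in msupp f -> ge m m' &
                t = f@_m *: 'X_[m]].

Definition initial_ideal (P : idealr {mpoly K[r]}) : {mpoly K[r]} -> Prop :=
  ideal_gen (fun t => exists f, [/\ f \in P, f != 0 & is_initial_term f t]).

End InitialIdeal.
End MonomialOrders.

Definition extended_ideal (k K : fieldType) (iota : {rmorphism k -> K})
    (r : nat) (I : idealr {mpoly k[r]}) : {mpoly K[r]} -> Prop :=
  ideal_gen (fun g => exists2 f, f \in I & g = map_mpoly iota f).

(* Main.v *)
Require Import Defs.
From HB Require Import structures.
From mathcomp Require Import all_boot all_order all_algebra.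
From mathcomp Require Import mpoly ring zify.
From Stdlib Require ClassicalEpsilon.

(* Let [H] be the graph on the variables in which [i], [j] are joined when the
   prime [(x_i, x_j)] does not contain [I].  Depth at the maximal ideals forces
   Koszul homology to vanish above degree 2, and read in squarefree degrees this
   says that the complex of faces (the Alexander dual of the Stanley-Reisner
   complex) is the clique complex of [H] and that [H] is chordal.  So the
   generators of [I] are [g_j], the product of the variables outside [C_j], for
   the maximal cliques [C_0, .., C_n] of [H], and a clique tree with parent
   function [p] yields the syzygies [A_j g_j = B_j g_(p j)] generating all
   syzygies.

   Since the [g_j] have the same degree, [A_j] and [B_j] have the same positive
   degree, so constants may be added to the syzygy matrix without changing
   leading forms.  Put [-1] just below the entry [A_j] of column [j] and two
   indeterminates at the top of the last column: the syzygies become a recursion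
   [f_(j+1) = A_j f_j - B_j f_(p j)], and the ideal of maximal minors
   [f_0, .., f_n] is generated by [f_0 = Q - t_0] and [f_1 = - P - t_1] with
   [P], [Q] over [k].  It is the ideal of the generic fibre of the polynomial
   map [(Q, - P)] over [K = k(t_0, t_1)], hence prime, and its initial ideal is
   generated by the [g_j]. *)

Set Implicit Arguments.
Unset Strict Implicit.
Unset Printing Implicit Defensive.

Import GRing.Theory.

Local Open Scope ring_scope.

(** * Ideals generated by a set *)

Section IdealGen.
Variables (A : comNzRingType) (G : A -> Prop).

Lemma ideal_gen0 : ideal_gen G 0.
Proof. by exists [::] => //; rewrite big_nil. Qed.

Lemma ideal_genD x y : ideal_gen G x -> ideal_gen G y -> ideal_gen G (x + y).
Proof.
move=> [s sG ->] [t tG ->]; exists (s ++ t); last by rewrite big_cat.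
by move=> p; rewrite mem_cat => /orP[/sG|/tG].
Qed.

Lemma ideal_genM a x : ideal_gen G x -> ideal_gen G (a * x).
Proof.
move=> [s sG ->]; exists [seq (a * p.1, p.2) | p <- s].
  by move=> _ /mapP[p /sG Gp ->].
by rewrite big_map mulr_sumr; apply: eq_bigr => p _; rewrite mulrA.
Qed.

Lemma ideal_genN x : ideal_gen G x -> ideal_gen G (- x).
Proof. by rewrite -mulN1r; apply: ideal_genM. Qed.

Lemma ideal_genB x y : ideal_gen G x -> ideal_gen G y -> ideal_gen G (x - y).
Proof. by move=> Gx /ideal_genN; apply: ideal_genD. Qed.

Lemma ideal_genBM x x' y y' :
  ideal_gen G (x - x') -> ideal_gen G (y - y') -> ideal_gen G (x * y - x' * y').
Proof.
move=> Gx Gy; rewrite (_ : _ - _ = y * (x - x') + x' * (y - y')); last by ring.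
by apply: ideal_genD; apply: ideal_genM.
Qed.

Lemma ideal_gen_mem x : G x -> ideal_gen G x.
Proof.
by move=> Gx; exists [:: (1, x)]; rewrite ?big_seq1 ?mul1r// => p; rewrite inE => /eqP->.
Qed.

Lemma ideal_gen_sum (T : Type) (s : seq T) (P : pred T) F :
  (forall i, P i -> ideal_gen G (F i)) -> ideal_gen G (\sum_(i <- s | P i) F i).
Proof. by move=> GF; elim/big_rec: _ => [|i x /GF]; [exact: ideal_gen0|exact: ideal_genD]. Qed.

Lemma ideal_gen_ind (P : A -> Prop) :
  P 0 -> (forall x y, P x -> P y -> P (x + y)) ->
  (forall a x, G x -> P (a * x)) -> forall x, ideal_gen G x -> P x.
Proof.
move=> P0 PD PM _ [s sG ->]; rewrite big_seq.
by elim/big_rec: _ => // p x /sG Gp; apply/PD/PM.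
Qed.

End IdealGen.

Lemma ideal_gen_take (A : comNzRingType) (s : seq A) i x :
  (i < size s)%N -> ideal_gen (fun y => y \in take i.+1 s) x ->
  exists c, ideal_gen (fun y => y \in take i s) (x - c * s`_i).
Proof.
move=> lt_is; elim/ideal_gen_ind => [|x1 x2 [c1 G1] [c2 G2]|a y].
- by exists 0; rewrite mul0r subr0; apply: ideal_gen0.
- exists (c1 + c2); rewrite mulrDl opprD addrACA; exact: ideal_genD.
- rewrite (take_nth 0)// mem_rcons inE => /orP[/eqP->|y_s].
    by exists a; rewrite subrr; apply: ideal_gen0.
  by exists 0; rewrite mul0r subr0; apply/ideal_genM/ideal_gen_mem.
Qed.

(** * Koszul complexes and depth *)

Section Koszul.
Variables (A : comNzRingType) (r : nat).
Implicit Types (t : {set 'I_r}) (f g : {set 'I_r} -> A) (u v w : 'I_r).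

(** The sign of moving [e_v] to its place in the exterior monomial [e_t]. *)
Definition insgn v t : A := (-1) ^+ #|[set u in t | (u < v)%N]|.

(** A chain is a function on all subsets; its part of degree [i] is the restriction to subsets of
    size [i]. This is the coefficient at [t] of its Koszul boundary, which for [y = 1] is the
    augmented simplicial boundary. *)
Definition koszul (y : 'I_r -> A) f t :=
  \sum_(v | v \notin t) insgn v t * y v * f (v |: t).

(** Exterior multiplication by [e_v]. *)
Definition wedge v f t := if v \in t then insgn v t * f (t :\ v) else 0.

Lemma insgn_sq v t : insgn v t * insgn v t = 1.
Proof. by rewrite /insgn -expr2 sqrr_sign. Qed.

Lemma insgnU u v t : v \notin t -> insgn u (v |: t) = (-1) ^+ (v < u)%N * insgn u t.
Proof.
move=> vt; rewrite /insgn -exprD; congr (_ ^+ _).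
case: (boolP (v < u)%N) => [vu|vu].
  have -> : [set w in v |: t | (w < u)%N] = v |: [set w in t | (w < u)%N].
    by apply/setP => w; rewrite !inE; case: eqVneq => // ->; rewrite vu.
  by rewrite cardsU1 !inE (negPf vt).
rewrite add0n; suff -> : [set w in v |: t | (w < u)%N] = [set w in t | (w < u)%N] by [].
apply/setP => w; rewrite !inE; case: eqVneq => // ->.
by rewrite (negPf vu) !andbF.
Qed.

Lemma insgnU1 v t : insgn v (v |: t) = insgn v t.
Proof.
rewrite /insgn; suff -> : [set w in v |: t | (w < v)%N] = [set w in t | (w < v)%N] by [].
apply/setP => w; rewrite !inE.
by case: eqVneq => // ->; rewrite ltnn !andbF.
Qed.

Lemma insgnD1 v t : insgn v (t :\ v) = insgn v t.
Proof.
have [/setD1K <-|vt] := boolP (v \in t); first by rewrite insgnU1 setU1K // !inE eqxx.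
congr insgn; apply/setP => w; rewrite !inE.
by case: eqVneq => // ->; rewrite (negPf vt).
Qed.

Lemma insgn_swap u v t : u != v -> u \notin t -> v \notin t ->
  insgn u t * insgn v (u |: t) = - (insgn v t * insgn u (v |: t)).
Proof.
move=> uv ut vt; rewrite !insgnU//.
have: (-1) ^+ (u < v)%N = - (-1) ^+ (v < u)%N :> A.
  by case: (ltngtP u v) => [||/val_inj/eqP]; rewrite ?(negPf uv) ?expr0 ?opprK.
by move=> ->; ring.
Qed.

Lemma eq_koszul y f g t : (forall v, v \notin t -> f (v |: t) = g (v |: t)) ->
  koszul y f t = koszul y g t.
Proof. by move=> fg; apply: eq_bigr => v /fg->. Qed.

Lemma koszulB y f g t : koszul y (fun s => f s - g s) t = koszul y f t - koszul y g t.
Proof. by rewrite /koszul -sumrB; apply: eq_bigr => v _; rewrite mulrBr. Qed.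

Lemma koszulD y f g t : koszul y (fun s => f s + g s) t = koszul y f t + koszul y g t.
Proof. by rewrite /koszul -big_split; apply: eq_bigr => v _; rewrite /= mulrDr. Qed.

Lemma koszulZ y a f t : koszul y (fun s => a * f s) t = a * koszul y f t.
Proof. by rewrite /koszul mulr_sumr; apply: eq_bigr => v _; rewrite mulrCA. Qed.

Lemma koszul_sum (T : finType) y (F : T -> {set 'I_r} -> A) t :
  koszul y (fun s => \sum_i F i s) t = \sum_i koszul y (F i) t.
Proof. by rewrite /koszul exchange_big /=; apply: eq_bigr => v _; rewrite mulr_sumr. Qed.

Lemma koszul_ideal (G : A -> Prop) y f t :
  (forall v, v \notin t -> ideal_gen G (f (v |: t))) -> ideal_gen G (koszul y f t).
Proof. by move=> Gf; apply: ideal_gen_sum => v /Gf; apply: ideal_genM. Qed.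

(** Cartan's homotopy formula: [wedge v] is a null-homotopy of multiplication by [y v], so the ideal
    of the [y v] annihilates Koszul homology. *)
Lemma koszul_wedge y v f t :
  koszul y (wedge v f) t + wedge v (koszul y f) t = y v * f t.
Proof.
rewrite /wedge; have [vt|vt] := boolP (v \in t); last first.
  rewrite addr0 /koszul (bigD1 v)//= big1 => [|w /andP[wt wv]].
    rewrite setU11 insgnU1 setU1K//.
    by rewrite addr0 [insgn v t * y v]mulrC -mulrA [insgn v t * (insgn v t * _)]mulrA insgn_sq mul1r.
  by rewrite !inE eq_sym (negPf wv) (negPf vt) mulr0.
rewrite /koszul [in X in _ + _ * X](bigD1 v) ?inE ?eqxx//= insgnD1 setD1K//.
rewrite mulrDr -!mulrA [insgn v t * (insgn v t * _)]mulrA insgn_sq mul1r addrCA.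
rewrite [X in _ + X](_ : _ = 0) ?addr0// mulr_sumr.
rewrite [X in _ + X](_ : _ = \sum_(i | i \notin t)
    insgn v t * (insgn i (t :\ v) * y i * f (i |: t :\ v))); last first.
  apply: eq_bigl => w; rewrite !inE; case: eqVneq => [->|]; last by rewrite andbT.
  by rewrite vt.
rewrite -big_split big1//= => w wt.
have wv : w != v by apply: contraNneq wt => ->.
rewrite in_setU vt orbT.
have -> : (w |: t) :\ v = w |: t :\ v.
  by apply/setP => x; rewrite !inE; case: (eqVneq x v) => // ->; rewrite eq_sym (negPf wv).
have swap : insgn w t * insgn v (w |: t) = - (insgn v t * insgn w (t :\ v)).
  rewrite -[in insgn w t](setD1K vt) -(insgnD1 v t).
  have -> : insgn v (w |: t) = insgn v (w |: t :\ v).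
    rewrite -(insgnD1 v (w |: t)) -(insgnD1 v (w |: t :\ v)); congr insgn.
    by apply/setP => x; rewrite !inE; case: (eqVneq x v).
  rewrite !insgnU ?inE ?eqxx ?(negPf wt) ?andbF//.
  have: (-1) ^+ (w < v)%N = - (-1) ^+ (v < w)%N :> A.
    by case: (ltngtP w v) => [||/val_inj/eqP]; rewrite ?(negPf wv) ?expr0 ?opprK.
  by move=> ->; case: (v < w)%N; rewrite ?expr0 ?expr1; ring.
transitivity ((insgn w t * insgn v (w |: t) + insgn v t * insgn w (t :\ v)) *
  (y w * f (w |: t :\ v))); first by ring.
by rewrite swap addNr mul0r.
Qed.

Lemma koszul_koszul y f t : koszul y (koszul y f) t = 0.
Proof.
pose F v w := insgn v t * insgn w (v |: t) * (y v * y w * f (w |: (v |: t))).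
have FN v w : v != w -> v \notin t -> w \notin t -> F v w + F w v = 0.
  by move=> vw vt wt; rewrite /F insgn_swap// setUCA [y w * y v]mulrC mulNr addNr.
transitivity (\sum_(v | v \notin t) \sum_(w | (w \notin t) && (v != w)) F v w).
  apply: eq_bigr => v vt; rewrite mulr_sumr; apply: eq_big => [w|w _].
    by rewrite !inE negb_or eq_sym andbC.
  by rewrite /F; ring.
transitivity (\sum_(v | v \notin t) \sum_(w | (w \notin t) && (v < w)%N) F v w +
   \sum_(v | v \notin t) \sum_(w | (w \notin t) && (w < v)%N) F v w).
  rewrite -big_split; apply: eq_bigr => v vt /=.
  rewrite (bigID (fun w : 'I_r => v < w)%N) /=; congr (_ + _); apply: eq_bigl => w;
  by case: (ltngtP v w) => [vw|vw|/val_inj ->];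
    rewrite ?eqxx ?andbF ?andbT// -val_eqE ?(ltn_eqF vw) ?(gtn_eqF vw) andbT.
rewrite [X in _ + X](exchange_big_dep (fun w => w \notin t))/=; last by move=> v w _ /andP[].
rewrite -big_split big1//= => v vt.
rewrite [X in _ + X](eq_bigl (fun w => (w \notin t) && (v < w)%N)); last first.
  by move=> w; rewrite vt.
rewrite -big_split big1//= => w /andP[wt vw]; apply: FN => //.
by rewrite -val_eqE (ltn_eqF vw).
Qed.

End Koszul.

(* Depth sensitivity of Koszul homology, in truncated form: above degree
   [r - size s] every cycle is a boundary.  The induction goes down along the
   quotients by initial segments of [s]; an element of [(y)] acts as zero on
   homology, and multiplication by the next element of [s] is injective. *)
Lemma koszul_acyclic (A : comNzRingType) (r : nat) (y : 'I_r -> A) (s : seq A) :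
  regular_sequence s ->
  (forall a, a \in s -> exists b : 'I_r -> A, a = \sum_v b v * y v) ->
  forall (i : nat) (f : {set 'I_r} -> A), (r < i + size s)%N ->
    (forall t : {set 'I_r}, #|t|.+1 = i -> koszul y f t = 0) ->
  exists g, forall t : {set 'I_r}, #|t| = i -> f t = koszul y g t.
Proof.
move=> [_ sreg] sy.
pose J j x := ideal_gen (fun z => z \in take j s) x.
(* Here [l] counts the elements of [s] not yet divided out. For [l = 0] the bound gives [i > r] and
   no set has size [i]; for [l = size s] the ideal [J 0] is zero. *)
suff H l : (l <= size s)%N -> forall (i : nat) (f : {set 'I_r} -> A), (r < i + l)%N ->
    (forall t : {set 'I_r}, #|t|.+1 = i -> J (size s - l)%N (koszul y f t)) ->
  exists g, forall t : {set 'I_r}, #|t| = i -> J (size s - l)%N (f t - koszul y g t).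
  have J0 x : J 0 x -> x = 0.
    by rewrite /J take0; elim/ideal_gen_ind => // x1 x2 -> ->; rewrite addr0.
  move=> i f ri fc; have := H _ (leqnn _) i f ri; rewrite subnn => -[t /fc ->|g gP].
    exact: ideal_gen0.
  by exists g => t /gP/J0/eqP; rewrite subr_eq0 => /eqP.
elim: l => [_ i f|l IH ls i f ril fc].
  rewrite addn0 => ri _; exists (fun=> 0) => t ti.
  by have := max_card (mem t); rewrite ti card_ord leqNgt ri.
set j := (size s - l.+1)%N in fc *.
have jS : (size s - l)%N = j.+1 by rewrite /j subnS prednK// subn_gt0.
have js : (j < size s)%N by rewrite /j ltn_subrL ltnS leq0n (leq_trans _ ls).
have {}IH := IH (ltnW ls); rewrite jS in IH.
set a := s`_j; have [b ab] := sy a (mem_nth 0 js).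
have JS x : J j x -> J j.+1 x.
  elim/ideal_gen_ind => [|x1 x2|]; [exact: ideal_gen0|exact: ideal_genD|].
  move=> c z zs; apply/ideal_genM/ideal_gen_mem.
  by rewrite (take_nth 0)// mem_rcons inE zs orbT.
have JSa c : J j.+1 (a * c).
  rewrite mulrC; apply/ideal_genM/ideal_gen_mem.
  by rewrite (take_nth 0)// mem_rcons inE eqxx.
(* Since [a] lies in the ideal of the [y v], the homotopy formula makes [a * f] the boundary of [g0]
   modulo [J j]. *)
pose g0 t := \sum_v b v * wedge v f t.
have g0E (t : {set 'I_r}) : #|t| = i -> J j (a * f t - koszul y g0 t).
  move=> ti; rewrite koszul_sum ab mulr_suml -sumrB; apply: ideal_gen_sum => v _.
  rewrite koszulZ -mulrA -koszul_wedge -mulrBr addrAC subrr add0r.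
  apply: ideal_genM; rewrite /wedge; case: ifP => vt; last exact: ideal_gen0.
  by apply/ideal_genM/fc; rewrite -ti [in RHS](cardsD1 v) vt.
(* Modulo [a] as well, [g0] is a cycle of degree [i.+1], hence a boundary up to a multiple [a * g1].
   Taking boundaries and cancelling [a] by regularity makes [f] the boundary of [g1] modulo
   [J j]. *)
have [|t [ti]|h hP] := IH i.+1 g0; first by rewrite addSnnS.
  rewrite -[koszul _ _ _](subKr (a * f t)); by apply: ideal_genB; [exact: JSa|exact/JS/g0E].
have [g1 g1P] : exists g1 : {set 'I_r} -> A, forall t : {set 'I_r}, #|t| = i.+1 ->
    J j (g0 t - koszul y h t - a * g1 t).
  apply: (@fin_all_exists _ _ (fun (t : {set 'I_r}) c => #|t| = i.+1 ->
    J j (g0 t - koszul y h t - a * c))) => t.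
  have [/hP/(ideal_gen_take js)[c cP]|ti] := eqVneq #|t| i.+1; last first.
    by exists 0 => /eqP; rewrite (negPf ti).
  by exists c => _; rewrite mulrC.
exists g1 => t ti; apply: sreg => //; rewrite -/a -/(J j _) mulrBr.
suff -> : a * f t - a * koszul y g1 t = (a * f t - koszul y g0 t) +
    koszul y (fun t : {set 'I_r} => g0 t - koszul y h t - a * g1 t) t.
  apply: ideal_genD; first exact: g0E.
  by apply: koszul_ideal => v vt; apply: g1P; rewrite cardsU1 vt ti.
rewrite koszulB koszulB koszul_koszul koszulZ; ring.
Qed.

(** * Squarefree monomials as sets of variables *)

Section SquarefreeMonomials.
Variable r : nat.
Implicit Types (t s : {set 'I_r}) (m : 'X_{1..r}).

Definition sqfree_mon t : 'X_{1..r} := [multinom (i \in t : nat) | i < r].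

Definition mon_supp m : {set 'I_r} := [set i | m i != 0]%N.

Lemma sqfree_monE t i : sqfree_mon t i = (i \in t) :> nat.
Proof. exact: mnmE. Qed.

Lemma mon_suppK t : mon_supp (sqfree_mon t) = t.
Proof. by apply/setP => i; rewrite inE sqfree_monE; case: (i \in t). Qed.

Lemma sqfree_mon_le t m : (sqfree_mon t <= m)%MM = (t \subset mon_supp m).
Proof.
apply/mnm_lepP/subsetP => [tm i it|tm i]; last first.
  by rewrite sqfree_monE; case: (boolP (i \in t)) => // /tm; rewrite inE lt0n.
by have := tm i; rewrite sqfree_monE it inE lt0n.
Qed.

Lemma sqfree_monU t s : [disjoint t & s] ->
  sqfree_mon (t :|: s) = (sqfree_mon t + sqfree_mon s)%MM.
Proof.
move=> /pred0P dis; apply/mnmP => i; rewrite mnmDE !sqfree_monE inE.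
by have := dis i; rewrite /=; case: (i \in t); case: (i \in s).
Qed.

Lemma sqfree_mon1U v t : v \notin t -> sqfree_mon (v |: t) = (U_(v) + sqfree_mon t)%MM.
Proof.
move=> vt; apply/mnmP => i; rewrite mnmDE mnm1E !sqfree_monE !inE.
by rewrite eq_sym; case: eqVneq => // <-; rewrite (negPf vt).
Qed.

Lemma mdeg_sqfree_mon t : mdeg (sqfree_mon t) = #|t|.
Proof.
by rewrite mdegE -sum1_card [RHS]big_mkcond; apply: eq_bigr => i _; rewrite sqfree_monE; case: ifP.
Qed.

End SquarefreeMonomials.

(** * Squarefree monomial ideals and their face complexes *)

Section Faces.
Variables (k : fieldType) (r : nat) (I : idealr {mpoly k[r]}).
Hypothesis I_sqfree : squarefree_monomial_ideal I.
Implicit Types (t s W : {set 'I_r}) (m : 'X_{1..r}).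

(* Faces of the Alexander dual of the Stanley-Reisner complex of [I]; its
   minimal nonfaces are the variable sets of the minimal primes of [I]. *)
Definition face t := 'X_[k, sqfree_mon (~: t)] \in I.

Lemma idealX_le m m' : 'X_[m] \in I -> (m <= m')%MM -> 'X_[m'] \in I.
Proof. by move=> mI /submK <-; rewrite mpolyXD idealMr. Qed.

Lemma face_subset t s : t \subset s -> face s -> face t.
Proof.
by move=> ts /idealX_le; apply; rewrite sqfree_mon_le mon_suppK setCS.
Qed.

(** A squarefree generator divides a monomial as soon as it divides the product of the variables
    occurring in it, so exponents do not matter. *)
Lemma mem_monomial_ideal f :
  f \in I <-> (forall m, m \in msupp f -> face (~: mon_supp m)).
Proof.
have [B sqB /(_ _) BI] := I_sqfree; split; last first.
  move=> fI; rewrite [f]mpolyE big_seq; apply: rpred_sum => m /fI.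
  rewrite /face setCK -mul_mpolyC => /idealX_le mI; apply/idealMr/mI.
  by rewrite sqfree_mon_le.
move/BI; elim/ideal_gen_ind => [|f1 f2 IH1 IH2|a _ [b /[dup] /sqB b1 Bb ->]] m.
- by rewrite msupp0.
- by move/msuppD_le; rewrite mem_cat => /orP[/IH1|/IH2].
rewrite mulrC => /msuppM_le/allpairsP[[m1 m2]/= []]; rewrite msuppX inE => /eqP-> _ ->.
have: 'X_[k, b] \in I by apply/BI/ideal_gen_mem; exists b.
rewrite /face setCK => /idealX_le; apply; apply/mnm_lepP => i.
rewrite sqfree_monE inE mnmDE addn_eq0; have := b1 i.
by case: (b i) => [|[|]].
Qed.

Lemma memX_ideal m : ('X_[m] \in I) = face (~: mon_supp m).
Proof.
apply/idP/idP => [/mem_monomial_ideal|mI]; first by apply; rewrite msuppX inE.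
by apply/mem_monomial_ideal => m'; rewrite msuppX inE => /eqP->.
Qed.

(** Generators of the maximal ideal of the point with coordinates 0 on [W] and 1 off [W]. Near it
    the variables off [W] are units, which isolates the induced complex on [W]. *)
Definition koszul_pt W (v : 'I_r) : {mpoly k[r]} := 'X_v - (v \notin W)%:R.

Definition restrict_to W (v : 'I_r) : {mpoly k[r]} := if v \in W then 'X_v else 1.

Definition slice W t (p : {mpoly k[r]}) : k :=
  (mmap (@mpolyC r k) (restrict_to W) p)@_(sqfree_mon (W :\: t)).

Lemma slice_sum W t (T : Type) (e : seq T) P (F : T -> {mpoly k[r]}) :
  slice W t (\sum_(i <- e | P i) F i) = \sum_(i <- e | P i) slice W t (F i).
Proof. by rewrite /slice rmorph_sum raddf_sum. Qed.

Lemma sliceZ W t c p : slice W t (c *: p) = c * slice W t p.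
Proof. by rewrite /slice mmapZ /= mcoeffCM. Qed.

(** For [v] in [W] the factor is ['X_v] and shifts the coefficient that is read; off [W] it
    specializes to 0. Slicing thus turns the Koszul boundary into the simplicial boundary on [W]. *)
Lemma slice_pt W t v p : v \notin t ->
  slice W t (koszul_pt W v * p) = if v \in W then slice W (v |: t) p else 0.
Proof.
move=> vt; rewrite /slice rmorphM /koszul_pt rmorphB rmorph_nat /= mmapX mmap1U /restrict_to.
case: ifP => vW /=; last by rewrite subrr mul0r mcoeff0.
rewrite subr0 mulrC.
have -> : W :\: t = v |: (W :\: (v |: t)).
  by apply/setP => x; rewrite !inE; case: eqVneq => // ->; rewrite vt vW.
by rewrite sqfree_mon1U ?inE ?eqxx// mcoeffMX.
Qed.

Lemma restrictX W m :
  mmap1 (restrict_to W) m = 'X_[[multinom if i \in W then m i else 0%N | i < r]].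
Proof.
rewrite mpolyXE_id; apply: eq_bigr => i _; rewrite mnmE /restrict_to.
by case: ifP; rewrite ?expr1n ?expr0.
Qed.

Lemma sliceX W t m : slice W t 'X_[m] =
  ([multinom if i \in W then m i else 0%N | i < r] == sqfree_mon (W :\: t))%:R.
Proof. by rewrite /slice mmapX restrictX mcoeffX. Qed.

(** A monomial of [I] seen by the slice involves no variable of [t], so [t] lies in the complement
    of its support, which is a face. *)
Lemma slice_face W t p : t \subset W -> p \in I -> slice W t p != 0 -> face t.
Proof.
move=> tW /mem_monomial_ideal pI; apply: contraR => tF.
rewrite [p]mpolyE slice_sum big_seq big1// => m /pI mI.
rewrite sliceZ sliceX; case: eqP => [E|]; last by rewrite mulr0.
have/negP[] := tF; apply: face_subset mI; apply/subsetP => x xt.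
move/mnmP/(_ x): E; rewrite mnmE sqfree_monE (subsetP tW)// !inE xt /=.
by move=> ->.
Qed.

Lemma insgnC v t : insgn {mpoly k[r]} v t = (insgn k v t)%:MP.
Proof. by rewrite /insgn rmorph_sign. Qed.

Lemma koszul_monomials W (c : {set 'I_r} -> k) s :
  (forall t, c t != 0 -> t \subset W) ->
  koszul (koszul_pt W) (fun t => c t *: 'X_[sqfree_mon (~: t)]) s
    = koszul (fun=> 1) c s *: 'X_[sqfree_mon (~: s)].
Proof.
move=> cW; rewrite /koszul scaler_suml; apply: eq_bigr => v vs.
have [->|/cW] := eqVneq (c (v |: s)) 0; first by rewrite scale0r !mulr0 scale0r.
rewrite subUset sub1set => /andP[vW _]; rewrite /koszul_pt vW subr0 mulr1.
have -> : ~: s = v |: ~: (v |: s).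
  by apply/setP => x; rewrite !inE; case: eqVneq => // ->; rewrite vs.
rewrite sqfree_mon1U ?inE ?eqxx//= mpolyXD -!mul_mpolyC insgnC !rmorphM; ring.
Qed.

(* Every simplicial cycle in the induced complex on [W] whose Koszul lift is
   controlled bounds: cone the cycle off in the full simplex, correct by a
   Koszul boundary, and read off squarefree coefficients. *)
Lemma face_cycle_bounds W (v0 : 'I_r) q (z : {set 'I_r} -> k) :
  (forall f : {set 'I_r} -> {mpoly k[r]},
     (forall t, #|t| = q -> koszul (koszul_pt W) f t \in I) ->
   exists g, forall t : {set 'I_r}, #|t| = q.+1 -> f t - koszul (koszul_pt W) g t \in I) ->
  v0 \in W ->
  (forall t, z t != 0 -> [/\ t \subset W, face t & #|t| = q]) ->
  (forall s : {set 'I_r}, #|s|.+1 = q -> koszul (fun=> 1) z s = 0) ->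
  exists2 c : {set 'I_r} -> k,
    (forall t, c t != 0 -> [/\ t \subset W, face t & #|t| = q.+1]) &
    (forall s : {set 'I_r}, #|s| = q -> z s = koszul (fun=> 1) c s).
Proof.
move=> acyc v0W zP zcyc.
pose w t : {mpoly k[r]} := wedge v0 z t *: 'X_[sqfree_mon (~: t)].
have wE s : #|s| = q -> koszul (koszul_pt W) w s = z s *: 'X_[sqfree_mon (~: s)].
  move=> sq; rewrite koszul_monomials => [|t]; last first.
    rewrite /wedge; case: ifP => [v0t|]; last by rewrite eqxx.
    rewrite mulf_eq0 negb_or => /andP[_ /zP[tW _ _]].
    by rewrite -(setD1K v0t) subUset sub1set v0W.
  congr (_ *: _); have := koszul_wedge (fun=> 1) v0 z s; rewrite mul1r => <-.
  rewrite [wedge _ _ _](_ : _ = 0) ?addr0// /wedge; case: ifP => // v0s.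
  by rewrite zcyc ?mulr0// -sq [in RHS](cardsD1 v0) v0s.
have [g gP] : exists g, forall t : {set 'I_r}, #|t| = q.+1 ->
    w t - koszul (koszul_pt W) g t \in I.
  apply: acyc => s /wE->; have [->|/zP[_ sF _]] := eqVneq (z s) 0.
    by rewrite scale0r idealr0.
  by rewrite -mul_mpolyC idealMr.
(* On sets of size [q.+1] the values of [u] lie in [I], and [u] has the same Koszul boundary as [w];
   so its slices are supported on faces and have boundary [z]. *)
pose u t := w t - koszul (koszul_pt W) g t.
pose c t := if (#|t| == q.+1) && (t \subset W) then slice W t (u t) else 0.
exists c => [t|s sq].
  rewrite /c; case: ifP => [/andP[/eqP tq tW] u0|]; last by rewrite eqxx.
  by split=> //; apply: slice_face u0 => //; apply: gP.
have [sW|sW] := boolP (s \subset W); last first.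
  have [->|/zP[]] := eqVneq (z s) 0; last by rewrite (negPf sW).
  symmetry; apply: big1 => v vs; rewrite /c subUset (negPf sW) !andbF.
  by rewrite mulr0.
transitivity (slice W s (koszul (koszul_pt W) u s)).
  rewrite koszulB koszul_koszul subr0 wE// sliceZ sliceX.
  case: eqP => [_|[]]; first by rewrite mulr1.
  apply/mnmP => i.
  by rewrite mnmE !sqfree_monE !inE andbC; case: (i \in W).
rewrite /koszul slice_sum; apply: eq_bigr => v vs.
rewrite -mulrA insgnC mul_mpolyC sliceZ slice_pt// mulr1.
by rewrite /c cardsU1 vs sq eqxx subUset sub1set sW andbT; case: ifP.
Qed.

End Faces.

(** * Prime ideals from closed predicates *)

Section PrimeOfClosed.
Variables (A : comNzRingType) (S : A -> bool).
Hypotheses (S_ideal : idealr_closed S) (S_prime : prime_idealr_closed S).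

(** A named copy of [S] to which the ideal structures can be attached. *)
Definition closed_pred : A -> bool := S.

HB.instance Definition _ := isIdealr.Build A closed_pred S_ideal.
HB.instance Definition _ := isPrimeIdealrClosed.Build A closed_pred S_prime.

Lemma prime_idealr_of_closed : {Q : prime_idealr A | forall x, (x \in Q) = S x}.
Proof. by exists (closed_pred : prime_idealr A). Qed.

End PrimeOfClosed.

Lemma mpoly_ring_ind (R : comNzRingType) n (P : {mpoly R[n]} -> Prop) :
  (forall c, P c%:MP) -> (forall i, P 'X_i) ->
  (forall p q, P p -> P q -> P (p + q)) -> (forall p q, P p -> P q -> P (p * q)) ->
  forall p, P p.
Proof.
move=> PC PX PD PM p; rewrite [p]mpolyE.
elim/big_rec: _ => [|m q _ Pq]; first exact: (PC 0).
apply: (PD _ _ _ Pq); rewrite -mul_mpolyC; apply: (PM) => //; rewrite mpolyXE_id.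
elim/big_rec: _ => [|i s _ Ps]; first exact: (PC 1).
apply: (PM _ _ _ Ps); elim: (m i) => [|d IH]; first by rewrite expr0; apply: (PC 1).
by rewrite exprS; apply: (PM).
Qed.

(** * Koszul acyclicity at 0-1 points of a Cohen-Macaulay quotient *)

Section PointKoszul.
Variables (k : fieldType) (r : nat) (I : idealr {mpoly k[r]}).
Hypothesis I_sqfree : squarefree_monomial_ideal I.
Variables (W : {set 'I_r}) (a b : 'I_r).
Hypotheses (aW : a \in W) (bW : b \in W) (ab : a != b) (nab : ~~ face I [set a; b]).

Let A := {ideal_quot I}.
Let R := {mpoly k[r]}.

(** The order in which variables are specialized: once [a] and [b] are set to 0 the ideal [I]
    vanishes, and each later variable adds one step to a chain of primes. *)
Let e := a :: b :: [seq v <- enum 'I_r | v \notin [:: a; b]].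

Let pt v : R := (v \notin W)%:R.
Let sub j v : R := if (index v e < j)%N then pt v else 'X_v.
Let sb j : R -> R := mmap (@mpolyC r k) (sub j).

Let sbX j v : sb j 'X_v = sub j v.
Proof. by rewrite /sb mmapX mmap1U. Qed.

Let sbC j c : sb j c%:MP = c%:MP.
Proof. by rewrite /sb mmapC. Qed.

Let sbD j : {morph sb j : p q / p + q}.
Proof. by move=> p q; rewrite /sb rmorphD. Qed.

Let sbB j : {morph sb j : p q / p - q}.
Proof. by move=> p q; rewrite /sb rmorphB. Qed.

Let sbM j : {morph sb j : p q / p * q}.
Proof. by move=> p q; rewrite /sb rmorphM. Qed.

Let e_uniq : uniq e.
Proof.
rewrite /= !inE negb_or ab !mem_filter !inE !eqxx orbT /=.
by rewrite filter_uniq ?enum_uniq.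
Qed.

Let mem_e v : v \in e.
Proof.
by rewrite /e !inE mem_filter mem_enum !inE andbT; case: (v == a); case: (v == b).
Qed.

Let size_e : size e = r.
Proof.
rewrite -[RHS]card_ord -(card_uniqP e_uniq); apply: eq_card => v.
by rewrite mem_e.
Qed.

Let sb_comp i j p : (i <= j)%N -> sb j (sb i p) = sb j p.
Proof.
move=> ij; elim/mpoly_ring_ind: p => [c|v|p q IHp IHq|p q IHp IHq].
- by rewrite !sbC.
- rewrite !sbX /sub; case: ifP => [vi|_]; last by rewrite sbX.
  rewrite (leq_trans vi ij) /pt; case: (v \notin W).
    by rewrite -[1%:R]mpolyC1 sbC.
  by rewrite -[0%:R](@mpolyC0 r k) sbC.
- by rewrite !sbD IHp IHq.
- by rewrite !sbM IHp IHq.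
Qed.

(** As [[set a; b]] is not a face, every monomial of [I] involves [a] or [b], and both take the
    value 0 because they lie in [W]. *)
Let sb_ideal j p : (2 <= j)%N -> p \in I -> sb j p = 0.
Proof.
move=> j2 /(mem_monomial_ideal I_sqfree) pI; rewrite -(sb_comp _ j2).
suff -> : sb 2 p = 0 by rewrite /sb mmap0.
rewrite /sb /mmap big_seq big1// => m /pI mF.
suff /existsP[v /andP[m0 /orP vab]] : [exists v, (m v != 0)%N && ((v == a) || (v == b))].
  suff sv0 : sub 2 v = 0.
    by rewrite /mmap1 (bigD1 v)//= sv0 expr0n (negPf m0) mul0r mulr0.
  rewrite /sub /pt; case: vab => /eqP->; rewrite /= ?eqxx ?aW ?bW//.
  by case: eqP => //=; rewrite ?eqxx ?bW.
apply: contraR nab => /existsPn mv; apply: face_subset mF.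
apply/subsetP => v; rewrite !inE => vab; have := mv v.
by rewrite vab andbT.
Qed.

Let pi (p : R) : A := \pi_({ideal_quot I})%qT p.

Let piE p q : (pi p == pi q) = (p - q \in I).
Proof. by rewrite Quotient.idealrBE. Qed.

Let pi0 p : (pi p == 0) = (p \in I).
Proof. by have := piE p 0; rewrite subr0 /pi rmorph0. Qed.

(** The substitution read on representatives; by [phi_pi] the choice is immaterial from [j = 2]
    on. *)
Let phi j (x : A) : R := sb j (repr x).

Let phi_pi j p : (2 <= j)%N -> phi j (pi p) = sb j p.
Proof.
move=> j2; apply/eqP; rewrite -subr_eq0 -sbB sb_ideal//.
by rewrite -piE /pi reprK.
Qed.

Let piK x : pi (repr x) = x.
Proof. exact: reprK. Qed.

(** The kernel of a map to a domain is prime; the shift by 2 starts the chain where [I] already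
    vanishes. *)
Let chain_ex j : {Q : prime_idealr A | forall x, (x \in Q) = (phi j.+2 x == 0)}.
Proof.
have p0 : phi j.+2 0 = 0.
  by rewrite -[0 in LHS](rmorph0 (\pi_({ideal_quot I})%qT)) -/(pi _) phi_pi// /sb mmap0.
have p1 : phi j.+2 1 = 1.
  rewrite -[1 in LHS](rmorph1 (\pi_({ideal_quot I})%qT)) -/(pi _) phi_pi//.
  by rewrite -mpolyC1 sbC.
have pD : {morph phi j.+2 : u v / u + v}.
  by move=> u v; rewrite -(piK u) -(piK v) -rmorphD /= -!/(pi _) !phi_pi// sbD.
have pM : {morph phi j.+2 : u v / u * v}.
  by move=> u v; rewrite -(piK u) -(piK v) -rmorphM /= -!/(pi _) !phi_pi// sbM.
apply: (@prime_idealr_of_closed _ (fun x => phi j.+2 x == 0)).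
  split=> [||x u v]; rewrite /in_mem/= ?p0 ?p1 ?eqxx ?oner_eq0//.
  by move=> /eqP u0 /eqP v0; rewrite pD pM u0 v0 mulr0 addr0.
by move=> u v; rewrite /in_mem/= pM mulf_eq0.
Qed.

Let chain j : prime_idealr A := sval (chain_ex j).

Let chainE j x : (x \in chain j) = (phi j.+2 x == 0).
Proof. exact: (svalP (chain_ex j)). Qed.

Let r_ge2 : (2 <= r)%N.
Proof. by rewrite -size_e. Qed.

Let M := chain (r - 2).

Let ME x : (x \in M) = (sb r (repr x) == 0).
Proof. by rewrite /M chainE -addn2 subnK. Qed.

Let sub_pt v : sub r v = pt v.
Proof. by rewrite /sub -[X in (_ < X)%N]size_e index_mem mem_e. Qed.

(** Specializing the next variable [v] adds ['X_v - pt v] to the kernel, so the inclusions are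
    strict. *)
Let M_chain : prime_chain M (r - 2).
Proof.
exists chain => // i ir; split=> [x|].
  move=> xi; have /eqP x0 : phi i.+2 x == 0 by rewrite -chainE.
  rewrite chainE; move: x0; rewrite /phi => x0.
  by rewrite -(sb_comp _ (leqnSn i.+2)) x0 /sb mmap0.
have ie : (i.+2 < size e)%N by rewrite size_e; lia.
pose v := nth a e i.+2.
have sbpt j : sb j (pt v) = pt v by rewrite /pt -!mpolyC_nat sbC.
have vi1 : pi ('X_v - pt v) \in chain i.+1.
  by rewrite chainE phi_pi// sbB sbX sbpt /sub /v index_uniq// ltnSn subrr.
move=> /(_ _ vi1); rewrite chainE phi_pi// sbB sbX sbpt /sub /v index_uniq// ltnn.
rewrite subr_eq0 => /eqP/(congr1 (mcoeff U_(v))).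
rewrite mcoeffX eqxx /pt -mpolyC_nat mcoeffC mnm1_eq0 mulr0 => /eqP.
by rewrite oner_eq0.
Qed.

Let sbr_const p : exists c, sb r p = c%:MP.
Proof.
elim/mpoly_ring_ind: p => [c|v|p q [c IHp] [d IHq]|p q [c IHp] [d IHq]].
- by exists c; rewrite sbC.
- by exists (v \notin W)%:R; rewrite sbX sub_pt /pt mpolyC_nat.
- by exists (c + d); rewrite sbD IHp IHq mpolyCD.
- by exists (c * d); rewrite sbM IHp IHq mpolyCM.
Qed.

(** Every element is congruent to a constant modulo [M], so a larger ideal would contain a unit. *)
Let M_maximal : maximal_ideal M.
Proof.
move=> J MJ x xJ; rewrite ME; have [c cE] := sbr_const (repr x).
rewrite cE mpolyC_eq0; apply/negPn/negP => c0.
have /MJ cJ : x - pi c%:MP \in M.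
  by rewrite -(piK x) -rmorphB /= -/(pi _) /M chainE phi_pi// -addn2 subnK// sbB cE sbC subrr.
have : pi c%:MP \in J by rewrite -(subKr x (pi _)) rpredB.
move/(idealMr (pi (c^-1)%:MP)); rewrite -rmorphM -mpolyCM mulVf//.
by rewrite mpolyC1 rmorph1 idealr1.
Qed.

Let M_gen p : exists c : 'I_r -> R, p - sb r p = \sum_v c v * koszul_pt k W v.
Proof.
elim/mpoly_ring_ind: p => [c|v|p q [c IHp] [d IHq]|p q [c IHp] [d IHq]].
- by exists (fun=> 0); rewrite sbC subrr big1// => v _; rewrite mul0r.
- exists (fun w => (w == v)%:R); rewrite (bigD1 v)//= eqxx mul1r sbX sub_pt.
  by rewrite big1 ?addr0// => w /negPf->; rewrite mul0r.
- exists (fun v => c v + d v); rewrite sbD opprD addrACA IHp IHq -big_split.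
  by apply: eq_bigr => v _; rewrite mulrDl.
- exists (fun v => q * c v + sb r p * d v).
  transitivity (q * (p - sb r p) + sb r p * (q - sb r q)); first by rewrite sbM; ring.
  rewrite IHp IHq !mulr_sumr -big_split.
  by apply: eq_bigr => v _; rewrite mulrDl !mulrA.
Qed.

(** The chain below [M] gives height at least [r - 2]; Cohen-Macaulayness turns this into a regular
    sequence in [M] of at least that length, and depth sensitivity kills Koszul homology from degree
    3 on. *)
Lemma cohen_macaulay_koszul_acyclic i (f : {set 'I_r} -> R) :
  cohen_macaulay {ideal_quot I} -> (3 <= i)%N ->
  (forall t : {set 'I_r}, #|t|.+1 = i -> koszul (koszul_pt k W) f t \in I) ->
  exists g, forall t : {set 'I_r}, #|t| = i -> f t - koszul (koszul_pt k W) g t \in I.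
Proof.
move=> [_ /(_ M M_maximal)[d [[s [s_reg sM sd]] _] [_ /(_ _ M_chain) rd]]] i3 fI.
have koszul_pi g t : koszul (fun v => pi (koszul_pt k W v)) (fun t => pi (g t)) t =
    pi (koszul (koszul_pt k W) g t).
  rewrite /koszul [pi _]rmorph_sum; apply: eq_bigr => v _.
  by rewrite /insgn -/pi !rmorphM rmorph_sign.
have sgen x : x \in s -> exists c : 'I_r -> A, x = \sum_v c v * pi (koszul_pt k W v).
  move=> /sM; rewrite ME => /eqP x0; have [c] := M_gen (repr x).
  rewrite x0 subr0 => /(congr1 pi); rewrite piK => ->.
  by exists (fun v => pi (c v)); rewrite /pi rmorph_sum; apply: eq_bigr => v _; rewrite rmorphM.
have [||g gP] := @koszul_acyclic _ r _ s s_reg sgen i (fun t => pi (f t)).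
- by rewrite sd; lia.
- by move=> t /fI; rewrite koszul_pi -pi0 => /eqP.
exists (fun t => repr (g t)) => t /gP E; rewrite -piE E -koszul_pi; apply/eqP.
by apply: eq_koszul => v _; rewrite piK.
Qed.

End PointKoszul.

(** * Primes generated by variables, and codimension 2 *)

Section VariablePrimes.
Variables (k : fieldType) (r : nat).
Let R := {mpoly k[r]}.
Implicit Types (t s : {set 'I_r}) (p q : R).

Definition kill t : R -> R :=
  mmap (@mpolyC r k) (fun v => if v \in t then 0 else 'X_v).

Lemma killX t v : kill t 'X_v = if v \in t then 0 else 'X_v.
Proof. by rewrite /kill mmapX mmap1U. Qed.

Lemma killC t c : kill t c%:MP = c%:MP.
Proof. by rewrite /kill mmapC. Qed.

Lemma killD t : {morph kill t : p q / p + q}.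
Proof. by move=> p q; rewrite /kill rmorphD. Qed.

Lemma killM t : {morph kill t : p q / p * q}.
Proof. by move=> p q; rewrite /kill rmorphM. Qed.

Lemma variable_prime_ex t : {Q : prime_idealr R | forall p, (p \in Q) = (kill t p == 0)}.
Proof.
apply: (@prime_idealr_of_closed _ (fun p => kill t p == 0)).
  split=> [||x u v]; rewrite /in_mem/=.
  - by rewrite /kill mmap0.
  - by rewrite -mpolyC1 killC mpolyC1 oner_eq0.
  by move=> /eqP u0 /eqP v0; rewrite killD killM u0 v0 mulr0 addr0.
by move=> u v; rewrite /in_mem/= killM mulf_eq0.
Qed.

Definition variable_prime t : prime_idealr R := sval (variable_prime_ex t).

Lemma variable_primeE t p : (p \in variable_prime t) = (kill t p == 0).
Proof. exact: (svalP (variable_prime_ex t)). Qed.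

Lemma variable_primeX t v : ('X_v \in variable_prime t) = (v \in t).
Proof.
rewrite variable_primeE killX; case: ifP => _; first exact: eqxx.
by apply/eqP => /(congr1 (mcoeff U_(v)))/eqP; rewrite mcoeffX mcoeff0 eqxx oner_eq0.
Qed.

Lemma variable_prime_min t (J : idealr R) :
  (forall v, v \in t -> 'X_v \in J) -> {subset variable_prime t <= J}.
Proof.
move=> tJ p; rewrite variable_primeE => /eqP p0; rewrite -[p]subr0 -p0.
elim/mpoly_ring_ind: p {p0} => [c|v|p q IHp IHq|p q IHp IHq].
- by rewrite killC subrr idealr0.
- by rewrite killX; case: ifP => [/tJ|]; rewrite ?subr0 ?subrr ?idealr0.
- by rewrite killD opprD addrACA rpredD.
- rewrite killM [_ - _](_ : _ = q * (p - kill t p) + kill t p * (q - kill t q)); last by ring.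
  by apply: rpredD; apply: idealMr.
Qed.

Lemma variable_prime_subsetN t s v : v \in t -> v \notin s ->
  ~ {subset variable_prime t <= variable_prime s}.
Proof.
move=> vt vs /(_ 'X_v); have Xt : 'X_v \in variable_prime t by rewrite variable_primeX.
by move=> /(_ Xt); rewrite variable_primeX (negPf vs).
Qed.

Lemma variable_prime_subset t s : t \subset s ->
  {subset variable_prime t <= variable_prime s}.
Proof. by move=> /subsetP ts; apply: variable_prime_min => v /ts; rewrite variable_primeX. Qed.

Lemma variable_prime1P v p : p \in variable_prime [set v] -> exists c, p = 'X_v * c.
Proof.
rewrite variable_primeE => /eqP p0.
suff [c] : exists c, p - kill [set v] p = 'X_v * c by rewrite p0 subr0; exists c.
elim/mpoly_ring_ind: p {p0} => [c|w|p q [c IHp] [d IHq]|p q [c IHp] [d IHq]].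
- by exists 0; rewrite killC subrr mulr0.
- rewrite killX inE; case: eqP => [->|_]; first by exists 1; rewrite subr0 mulr1.
  by exists 0; rewrite subrr mulr0.
- by exists (c + d); rewrite killD opprD addrACA IHp IHq mulrDr.
- exists (q * c + kill [set v] p * d); rewrite mulrDr mulrCA -IHp mulrCA -IHq killM.
  by ring.
Qed.

Lemma height_variable_prime1 v : height (variable_prime [set v]) 1.
Proof.
split.
  exists (fun i => variable_prime (if i is 0%N then set0 else [set v])) => // -[|//] _.
  split; first by apply: variable_prime_subset; rewrite sub0set.
  by apply: (@variable_prime_subsetN _ _ v); rewrite ?in_set1 ?in_set0.
move=> m [c cm cP]; rewrite leqNgt; apply/negP => m2.
have [m1 m0] : (m.-1 < m)%N /\ (m.-2 < m)%N by lia.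
have [_ ss0] := cP _ m0; have [ss1 ns1] := cP _ m1.
have e1 : m.-2.+1 = m.-1 by lia.
have e2 : m.-1.+1 = m by lia.
rewrite {}e1 {}e2 in ss0 ss1 ns1; set Q := c m.-1 in ss0 ss1 ns1.
have XQ : 'X_v \notin Q.
  apply: contra_notN ns1 => XQ x; rewrite cm.
  by apply: variable_prime_min => w; rewrite inE => /eqP->.
(* Descent on degree: [Q] lies in the ideal of ['X_v] without containing ['X_v], so [x = 'X_v * d]
   puts the smaller [d] in [Q]. *)
apply: ss0 => x xQ; suff -> : x = 0 by exact: idealr0.
have [n] := ubnP (msize x); elim: n => // n IH in x xQ *.
have [->//|x0] := eqVneq x 0.
have /variable_prime1P[d xE] : x \in variable_prime [set v] by rewrite -cm; apply: ss1.
have d0 : d != 0 by apply: contraNneq x0 => d0; rewrite xE d0 mulr0.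
have X0 : 'X_v != 0 :> R.
  by apply/eqP => /(congr1 (mcoeff U_(v)))/eqP; rewrite mcoeffX mcoeff0 eqxx oner_eq0.
have dQ : d \in Q by move: xQ; rewrite xE prime_idealrM (negPf XQ).
rewrite xE msizeM// msizeX mdeg1 /= ltnS => dn.
by case/eqP: d0; apply: IH.
Qed.

Variable (I : idealr R).
Hypothesis I_sqfree : squarefree_monomial_ideal I.

Lemma nonface_variable_prime t : ~~ face I t -> {subset I <= variable_prime t}.
Proof.
move=> tF p /(mem_monomial_ideal I_sqfree) pI; rewrite [p]mpolyE big_seq.
apply: rpred_sum => m /pI mI; rewrite -mul_mpolyC idealMr//.
have /existsP[v /andP[vt mv]] : [exists v, (v \in t) && (m v != 0)%N].
  apply: contraR tF => /existsPn tm; apply: face_subset mI.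
  by apply/subsetP => v vt; have := tm v; rewrite !inE vt negbK.
rewrite -(@submK _ U_(v)%MM m) ?lep1mP// mpolyXD idealMr//.
by rewrite variable_primeX.
Qed.

(** The variables of a nonface generate a prime containing [I]. A singleton would give height 1; the
    variables lying in a prime of height 2 over [I] form a nonface with exactly two elements. *)
Lemma codim2_nonface : codim I 2 ->
  (forall v, face I [set v]) /\ (exists a b, a != b /\ ~~ face I [set a; b]).
Proof.
move=> [[P IP hP] Imin].
have F1 v : face I [set v].
  apply/negPn/negP => /nonface_variable_prime /Imin/(_ (height_variable_prime1 v)).
  by [].
split=> //; have [chP maxP] := hP.
pose S := [set v | 'X_v \in P].
(* Otherwise the prime [P] would contain a product of variables none of which lies in [P]. *)
have SF : ~~ face I S.
  apply/negP => /IP; rewrite mpolyXE_id.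
  suff : forall e : seq 'I_r, all (fun v => v \notin S) e ->
      \prod_(i <- e) 'X_i ^+ sqfree_mon (~: S) i \notin P.
    have -> : (\prod_(i < r) 'X_i ^+ sqfree_mon (~: S) i : R) =
       \prod_(i <- enum (~: S)) 'X_i ^+ sqfree_mon (~: S) i.
      rewrite big_enum [LHS](bigID (mem (~: S)))/= [X in _ * X]big1 ?mulr1// => i.
      by rewrite sqfree_monE => /negPf->.
    by move=> /(_ (enum (~: S))) H; apply/negP/H; apply/allP => v; rewrite mem_enum inE.
  elim=> [_|v e IH /= /andP[vS /IH eS]]; first by rewrite big_nil idealr1.
  rewrite big_cons prime_idealrM negb_or eS andbT sqfree_monE in_setC vS expr1.
  by move: vS; rewrite inE.
have S2 : (#|S| <= 2)%N.
  rewrite leqNgt; apply/negP => /card_gt2P[x [y [z [[xS yS zS] [xy yz zx]]]]].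
  have := maxP 3; suff: prime_chain P 3 by move=> H /(_ H).
  (* The default value [P] of [nth] is the last prime of the chain. *)
  exists (fun i => nth P [:: variable_prime set0; variable_prime [set x];
    variable_prime [set x; y]] i) => // i i3.
  split; last first.
    move: i3; case: i => [|[|[|//]]] _ /=.
    - by apply: (@variable_prime_subsetN _ _ x); rewrite ?in_set1 ?in_set0.
    - by apply: (@variable_prime_subsetN _ _ y); rewrite ?in_set2 ?in_set1 ?eqxx ?orbT// eq_sym.
    - move=> /(_ 'X_z); rewrite !variable_primeX !inE; move: zS; rewrite inE => -> /(_ isT).
      by rewrite (negPf zx) eq_sym (negPf yz).
  move: i3; case: i => [|[|[|//]]] _ /=.
  - by apply: variable_prime_subset; rewrite sub0set.
  - by apply: variable_prime_subset; rewrite sub1set !inE eqxx.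
  - by apply: variable_prime_min => v; rewrite !inE => /orP[]/eqP->;
      [move: xS|move: yS]; rewrite inE.
have [S1|S1] := leqP #|S| 1; last first.
  have /cards2P[a [b [ab SE]]] : #|S| == 2 by rewrite eqn_leq S2.
  by exists a, b; rewrite ab -SE.
have [c _ /(_ 0%N isT)[_ c01]] := chP; exfalso.
(* A subset of a singleton is a face. Without variables the ring is the field [k], which has no
   strict inclusion of primes. *)
have [[v] |] : {v : 'I_r | S \subset [set v]} + (r = 0%N).
  have [S0|[v vS]] := set_0Vmem S.
    case: (posnP r) => [|r0]; [by right|left; exists (Ordinal r0)].
    by rewrite S0 sub0set.
  by left; exists v; apply/subsetP => w wS; rewrite inE; apply/eqP/(card_le1_eqP S1).
  by move=> /face_subset H; move: SF; rewrite (H _ I (F1 v)).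
move=> r0; apply: c01 => x xc; suff -> : x = 0 by exact: idealr0.
move: xc; rewrite (nvar0_mpolyC_eq x r0); have [->//|x0] := eqVneq x@_0%MM 0.
move/(idealMr (x@_0%MM)^-1%:MP); rewrite -mpolyCM mulVf//.
by rewrite mpolyC1 idealr1.
Qed.

End VariablePrimes.

(** * Vanishing homology: clique complexes, chordality and clique trees *)

Section OneLeray.
Variables (k : fieldType) (r : nat) (F : {set 'I_r} -> bool).
Implicit Types (s t S W X : {set 'I_r}) (a b u v x y : 'I_r).

Let bnd (c : {set 'I_r} -> k) t := koszul (fun=> 1) c t.

Hypothesis F_subset : forall t s, t \subset s -> F s -> F t.
Hypothesis F_vertex : forall v, F [set v].
(** Induced complexes with a missing edge have no homology in positive dimension; a set of size [q]
    is a simplex of dimension [q - 1]. *)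
Hypothesis F_bounds : forall W a b q (z : {set 'I_r} -> k),
  a \in W -> b \in W -> a != b -> ~~ F [set a; b] -> (2 <= q)%N ->
  (forall t, z t != 0 -> [/\ t \subset W, F t & #|t| = q]) ->
  (forall s, #|s|.+1 = q -> bnd z s = 0) ->
  exists2 c : {set 'I_r} -> k,
    (forall t, c t != 0 -> [/\ t \subset W, F t & #|t| = q.+1]) &
    (forall s, #|s| = q -> z s = bnd c s).

Let insgn_neq0 v t : insgn k v t != 0.
Proof. by rewrite /insgn signr_eq0. Qed.

Let simplex S t : k := (t == S)%:R.

Let bnd_simplex_supp S t : bnd (simplex S) t != 0 -> exists2 v, v \in S & t = S :\ v.
Proof.
move=> z0; suff /existsP[v /andP[vt /eqP <-]] : [exists v, (v \notin t) && (v |: t == S)].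
  by exists v; rewrite ?setU11// setU1K.
apply: contraR z0 => /existsPn vS; apply/eqP/big1 => v vt.
by have := vS v; rewrite vt andTb /simplex => /negPf->; rewrite mulr0.
Qed.

Let bnd_simplex S v : v \in S -> bnd (simplex S) (S :\ v) = insgn k v S.
Proof.
move=> vS; rewrite /bnd /koszul (bigD1 v) ?setD11//= big1 => [|w /andP[wS wv]].
  by rewrite addr0 insgnD1 mulr1 /simplex setD1K// eqxx mulr1.
rewrite /simplex; case: eqP => [/setP/(_ v)|]; last by rewrite mulr0.
by rewrite !inE eqxx eq_sym (negPf wv) vS.
Qed.

Let min_nonface S := ~~ F S /\ forall v, v \in S -> F (S :\ v).

Let F_pair x y : F [set x; y] = F [set y; x].
Proof. by rewrite setUC. Qed.

Let nonface_pair_sub t a b : a \in t -> b \in t -> ~~ F [set a; b] -> F t = false.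
Proof.
move=> ta tb; apply: contraNF; apply: F_subset.
by rewrite subUset !sub1set ta tb.
Qed.

(** The boundary of [S] would bound in the induced complex on [b |: S]. Only [T], which is [S] with
    [a] replaced by [b], can cover [S :\ a]; but [T] is also the only face covering [T :\ u], where
    the boundary of [S] is 0, so its coefficient vanishes. *)
Let min_nonface_meets S a b : min_nonface S -> (3 <= #|S|)%N ->
  a \in S -> b \notin S -> ~~ F [set a; b] -> False.
Proof.
move=> [SF Sfacet] S3 aS bS nab.
have ab : a != b by apply: contraNneq bS => <-.
have [|||||||c cP cE] := @F_bounds (b |: S) a b #|S|.-1 (bnd (simplex S)).
- by rewrite setU1r.
- by rewrite setU11.
- by [].
- by [].
- by lia.
- move=> t /bnd_simplex_supp[v vS ->]; split; last by rewrite [in RHS](cardsD1 v) vS.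
    by apply: subset_trans (subsetUr _ _); rewrite subsetDl.
  exact: Sfacet.
- by move=> t _; apply: koszul_koszul.
have [u] : exists u, u \in S :\ a.
  by apply/set0Pn; rewrite -card_gt0; move: S3; rewrite (cardsD1 a S) aS => /ltnW.
rewrite !inE => /andP[ua uS].
have ub : u != b by apply: contraNneq bS => <-.
pose T := b |: (S :\ a).
have cT : c T = 0.
  have := cE (b |: (S :\ a :\ u)).
  rewrite cardsU1 !inE (negPf bS) !andbF /=.
  have -> : (1 + #|S :\ a :\ u| = #|S|.-1)%N.
    by rewrite (cardsD1 a S) aS (cardsD1 u (S :\ a)) !inE ua uS.
  move=> /(_ erefl); have [|z0] := eqVneq (bnd (simplex S) (b |: (S :\ a :\ u))) 0; last first.
    have [v _ /setP/(_ b)] := bnd_simplex_supp z0.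
    by rewrite !inE eqxx (negPf bS) !andbF.
  move=> -> /esym/eqP; rewrite /bnd /koszul (bigD1 u)/=; last first.
    by rewrite !inE eqxx (negPf ub).
  rewrite big1 => [|v /andP[vS vu]]; last first.
    have [->|/cP[vW vF _]] := eqVneq (c (v |: (b |: (S :\ a :\ u)))) 0; first by rewrite mulr0.
    have va : v = a.
      move: vS vW; rewrite subUset sub1set !inE => /norP[vb].
      by rewrite vu /= (negPf vb) /= => vaS /andP[vS _]; move: vaS; rewrite vS andbT negbK => /eqP.
    by move: vF; rewrite (@nonface_pair_sub _ a b)// !inE ?va ?eqxx ?orbT.
  rewrite addr0 mulr1 mulf_eq0 (negPf (insgn_neq0 _ _)) /= => /eqP.
  rewrite setUCA setD1K// !inE ua uS //.
have := cE (S :\ a); rewrite bnd_simplex// (cardsD1 a S) aS => /(_ erefl) E.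
have /eqP[] := insgn_neq0 a S; rewrite {}E.
apply: big1 => v vSa; have [->|/cP[vW vF _]] := eqVneq (c (v |: (S :\ a))) 0.
  by rewrite mulr0.
have [va|va] := eqVneq v a; first by move: vF; rewrite va setD1K// (negPf SF).
have vb : v = b.
  move: vSa vW; rewrite subUset sub1set !inE va /= => /negPf vS.
  by rewrite vS orbF => /andP[/eqP].
by rewrite vb cT mulr0.
Qed.

Let exists_min_nonface t : ~~ F t -> exists2 S : {set 'I_r}, S \subset t & min_nonface S.
Proof.
move=> tF; have [S /minsetP[SF Smin] St] := minset_exists (P := fun t => ~~ F t) tF.
exists S => //; split=> // v vS; apply/negPn/negP => vF.
have := Smin _ vF (subsetDl _ _) => /setP/(_ v).
by rewrite !inE eqxx vS.
Qed.

(** The suspension of the boundary of [S] with apexes [a] and [b] is a sphere in the complex. A face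
    on its vertices misses an element of [S] and one of [a], [b], so none is large enough to fill
    it. *)
Let min_nonface_disjoint S a b : min_nonface S -> (3 <= #|S|)%N ->
  a \notin S -> b \notin S -> a != b -> ~~ F [set a; b] -> False.
Proof.
move=> Smin S3 aS bS ab nab.
(* A minimal nonface inside [x |: (S :\ v)] contains [x] and misses [y]. If it has at least three
   elements [min_nonface_meets] applies to it; if it is a pair, the same result applies to [S]. *)
have facet x y : x \notin S -> y \notin S -> x != y -> ~~ F [set x; y] ->
    forall v, v \in S -> F (x |: (S :\ v)).
  move=> xS yS xy nxy v vS; apply/negPn/negP => /exists_min_nonface[T Tsub Tmin].
  have xT : x \in T.
    apply: contraT => xT; case: Tmin => /negP[]; apply: F_subset (Smin.2 v vS).
    apply/subsetP => w wT; move: (subsetP Tsub _ wT); rewrite in_setU1.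
    by case: eqP => // wx; rewrite -wx wT in xT.
  have yT : y \notin T.
    by apply: contra yS => /(subsetP Tsub); rewrite !inE eq_sym (negPf xy) => /andP[].
  apply: (min_nonface_meets Tmin _ xT yT nxy); rewrite ltnNge; apply/negP => T2.
  have [T1|T1] := leqP #|T| 1.
    case: Tmin => /negP[]; apply: F_subset (F_vertex x).
    by apply/subsetP => w wT; rewrite inE; apply/eqP/(card_le1_eqP T1).
  have [y' y'T] : exists y', y' \in T :\ x.
    by apply/set0Pn; rewrite -card_gt0; move: T1; rewrite (cardsD1 x T) xT.
  move: y'T; rewrite !inE => /andP[y'x y'T].
  have TE : T = [set x; y'].
    apply/esym/eqP; rewrite eqEcard subUset !sub1set xT y'T cards2 eq_sym y'x.
    by rewrite (leq_trans T2).
  have y'S : y' \in S.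
    by have := subsetP Tsub _ y'T; rewrite !inE (negPf y'x) => /andP[].
  apply: (@min_nonface_meets S y' x) => //.
  by rewrite F_pair -TE; case: Tmin.
pose z t := wedge a (bnd (simplex S)) t - wedge b (bnd (simplex S)) t.
have wsupp x t : wedge x (bnd (simplex S)) t != 0 ->
    exists2 v, v \in S & t = x |: (S :\ v).
  rewrite /wedge; case: ifP => [xt|_]; last by rewrite eqxx.
  rewrite mulf_eq0 (negPf (insgn_neq0 _ _)) => /bnd_simplex_supp[v vS tE].
  by exists v => //; rewrite -tE setD1K.
have [|||||||c cP cE] := @F_bounds (a |: (b |: S)) a b #|S| z.
- by rewrite setU11.
- by rewrite !inE eqxx orbT.
- by [].
- by [].
- exact: ltnW.
- move=> t zt.
  have [x [v [xab vS ->]]] : exists x v, [/\ x \in [set a; b], v \in S & t = x |: (S :\ v)].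
    have [a0|/wsupp[v vS ->]] := eqVneq (wedge a (bnd (simplex S)) t) 0.
      move: zt; rewrite /z a0 sub0r oppr_eq0 => /wsupp[v vS ->].
      by exists b, v; rewrite !inE eqxx orbT.
    by exists a, v; rewrite !inE eqxx.
  have xS : x \notin S by move: xab; rewrite !inE => /orP[]/eqP->.
  split.
  + rewrite setUA subUset (subset_trans _ (subsetUl _ _)) ?sub1set//=.
    by apply: subset_trans (subsetUr _ _); rewrite subsetDl.
  + move: xab; rewrite !inE => /orP[]/eqP->; first exact: (facet a b).
    by apply: (facet b a); rewrite // 1?eq_sym// F_pair.
  + by rewrite cardsU1 !inE (negPf xS) andbF (cardsD1 v S) vS.
- move=> s _.
  have w1 x : bnd (wedge x (bnd (simplex S))) s = bnd (simplex S) s.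
    have := koszul_wedge (fun=> 1) x (bnd (simplex S)) s; rewrite mul1r -/(bnd _ _) => <-.
    rewrite [X in _ + X](_ : _ = 0) ?addr0// /wedge; case: ifP => // _.
    by rewrite [koszul _ _ _]koszul_koszul mulr0.
  by rewrite /z [LHS]koszulB -!/(bnd _ _) !w1 subrr.
have c0 t : c t = 0.
  apply/eqP/negPn/negP => /cP[tW tF tS].
  have [y yS yt] : exists2 y, y \in S & y \notin t.
    apply/subsetPn; apply/negP => St; case: Smin => /negP[].
    exact: F_subset tF.
  have [x xab xt] : exists2 x, x \in [set a; b] & x \notin t.
    apply/subsetPn; apply/negP => abt; move: nab.
    by rewrite (F_subset abt tF).
  have xS : x \notin S by move: xab; rewrite !inE => /orP[]/eqP->.
  have: t \subset (a |: (b |: S)) :\ x :\ y.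
    apply/subsetP => w wt; rewrite 2!in_setD1 (subsetP tW)// andbT.
    by apply/andP; split; [apply: contraNneq yt|apply: contraNneq xt] => <-.
  move/subset_leq_card; rewrite tS.
  have := cardsD1 x (a |: (b |: S)); have := cardsD1 y ((a |: (b |: S)) :\ x).
  have -> : y \in (a |: (b |: S)) :\ x.
    by rewrite !inE yS !orbT andbT; apply: contraNneq xS => <-.
  have -> : x \in a |: (b |: S).
    by move: xab; rewrite !inE => /orP[]->; rewrite ?orbT.
  rewrite !cardsU1 !inE (negPf ab) (negPf aS) (negPf bS) /=.
  by rewrite !add1n => -> [->]; rewrite ltnn.
have [v vS] : exists v, v \in S by apply/set0Pn; rewrite -card_gt0; apply: leq_trans S3.
have := cE (a |: (S :\ v)); rewrite cardsU1 !inE (negPf aS) andbF (cardsD1 v S) vS.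
move=> /(_ erefl); rewrite [RHS]big1 => [|w _]; last by rewrite c0 mulr0.
rewrite /z /wedge setU11 setU1K ?inE ?(negPf aS) ?andbF// bnd_simplex//.
rewrite ?inE (eq_sym b) (negPf ab) (negPf bS) ?andbF /= subr0 => /eqP.
by rewrite mulf_eq0 !(negPf (insgn_neq0 _ _)).
Qed.

(** A minimal nonface inside a clique has at least three elements and cannot contain both [a] and
    [b]; the two preceding results exclude the remaining positions. *)
Lemma faces_are_cliques a b t : a != b -> ~~ F [set a; b] ->
  (forall u v, u \in t -> v \in t -> u != v -> F [set u; v]) -> F t.
Proof.
move=> ab nab tP; apply/negPn/negP => /exists_min_nonface[S St Smin].
have SP u v : u \in S -> v \in S -> u != v -> F [set u; v].
  by move=> uS vS; apply: tP; rewrite (subsetP St).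
have S3 : (3 <= #|S|)%N.
  rewrite ltnNge; apply/negP => S2; have [SF Sfacet] := Smin.
  have [S1|S1] := leqP #|S| 1.
    have [S0|[x xS]] := set_0Vmem S.
      by move: SF; rewrite S0 (F_subset (sub0set _) (F_vertex a)).
    move/negP: SF; apply; apply: F_subset (F_vertex x).
    by apply/subsetP => w wT; rewrite inE; apply/eqP/(card_le1_eqP S1).
  have /cards2P[x [y [xy SE]]] : #|S| == 2 by rewrite eqn_leq S2.
  by move: SF; rewrite SE SP ?SE ?inE ?eqxx ?orbT.
have [aS|aS] := boolP (a \in S); have [bS|bS] := boolP (b \in S).
- by move: nab; rewrite SP.
- exact: (min_nonface_meets Smin S3 aS bS nab).
- by apply: (min_nonface_meets Smin S3 bS aS); rewrite F_pair.
- exact: (min_nonface_disjoint Smin S3 aS bS ab nab).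
Qed.

Let adj x y := (x != y) && F [set x; y].
Let adj_in X x y := [&& x \in X, y \in X & adj x y].

Let edge x y := wedge x (simplex [set y]).

Let edge_bnd x y p : x != y -> bnd (edge x y) [set p] = (p == y)%:R - (p == x)%:R.
Proof.
move=> xy; have := koszul_wedge (fun=> 1) x (simplex [set y]) [set p].
rewrite mul1r -/(bnd _ _) /simplex (inj_eq set1_inj) => <-; rewrite -/(edge x y) -addrA.
rewrite [X in _ + X](_ : _ = 0) ?addr0//; apply/eqP; rewrite subr_eq0; apply/eqP.
rewrite /wedge inE eq_sym; case: eqP => [->|]// .
have -> : [set x] :\ x = set0 by apply/setP => w; rewrite !inE; case: eqP.
rewrite /koszul (bigD1 y) ?inE//= big1 => [|w /andP[_ wy]]; last first.
  by rewrite /simplex setU0 (inj_eq set1_inj) (negPf wy) mulr0.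
rewrite /simplex setU0 eqxx /insgn !mulr1 addr0 -exprD (_ : _ + _ = 0)%N//.
apply/eqP; rewrite addn_eq0 !cards_eq0; apply/andP; split; apply/eqP/setP => w.
  by rewrite !inE; case: eqP => // ->; rewrite ltnn.
by rewrite !inE.
Qed.

Let edge_supp x y t : x != y -> edge x y t != 0 -> t = [set x; y].
Proof.
move=> xy; rewrite /edge /wedge; case: ifP => [xt|_]; last by rewrite eqxx.
rewrite mulf_eq0 negb_or /simplex => /andP[_]; case: (t :\ x =P [set y]) => [E _|_]; last by rewrite eqxx.
by rewrite -(setD1K xt) E.
Qed.

(** The boundaries of the oriented edges along a path telescope. *)
Let path_chain X x y : connect (adj_in X) x y ->
  exists2 c : {set 'I_r} -> k,
    (forall t, c t != 0 -> [/\ t \subset X, F t & #|t| = 2]) &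
    forall p, bnd c [set p] = (p == y)%:R - (p == x)%:R.
Proof.
move=> /connectP[e]; elim: e x => [|w e IH] x /=.
  move=> _ ->; exists (fun=> 0) => [t|p]; first by rewrite eqxx.
  by rewrite subrr [LHS]big1// => v _; rewrite mulr0.
case/andP => /and3P[xX wX /andP[xw Fxw]] /IH{}IH /IH[c cP cE].
exists (fun t => edge x w t + c t) => [t|p]; last first.
  rewrite [LHS]koszulD -!/(bnd _ _) cE edge_bnd// addrC -addrA.
  by rewrite [- _ + _]addrA addNr add0r.
have [e0|/(edge_supp xw) -> _] := eqVneq (edge x w t) 0.
  by rewrite e0 add0r; apply: cP.
by split; rewrite ?cards2 ?xw// subUset !sub1set xX wX.
Qed.

(* The cycle through [a], [u], [v] and back inside [X] can only bound if some
   triangle contains the edge [a, u]. *)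
Let separator_clique X a u v : a \notin X -> u \in X -> v \in X ->
  (forall x, x \in X -> F [set a; x] -> x = u \/ x = v) ->
  F [set a; u] -> F [set a; v] -> connect (adj_in X) u v -> u != v -> F [set u; v].
Proof.
move=> aX uX vX Xa au av uv u_v; apply/negPn/negP => nuv.
have a_u : a != u by apply: contraNneq aX => ->.
have a_v : a != v by apply: contraNneq aX => ->.
have v_a : v != a by rewrite eq_sym.
have [c cP cE] := path_chain uv.
pose z t := c t + edge v a t + edge a u t.
have zau : z [set a; u] = insgn k a [set a; u].
  rewrite /z; have [->|/cP[]] := eqVneq (c [set a; u]) 0; last first.
    by rewrite subUset sub1set (negPf aX).
  have [->|/(edge_supp v_a)/setP/(_ u)] := eqVneq (edge v a [set a; u]) 0; last first.
    by rewrite !inE eqxx orbT (negPf u_v) eq_sym (negPf a_u).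
  rewrite !add0r /edge /wedge setU11 setU1K ?inE// /simplex eqxx mulr1//.
have [|||||||c' cP' cE'] := @F_bounds (a |: X) u v 2 z.
- by rewrite setU1r.
- by rewrite setU1r.
- by [].
- by [].
- by [].
- move=> t; rewrite /z.
  have [->|/(edge_supp a_u) -> _] := eqVneq (edge a u t) 0; last first.
    by split; rewrite ?cards2 ?a_u// subUset !sub1set setU11 setU1r.
  have [->|/(edge_supp v_a) -> _] := eqVneq (edge v a t) 0; last first.
    by split; rewrite ?cards2 ?v_a// 1?F_pair// subUset !sub1set setU11 setU1r.
  rewrite !addr0 => /cP[tX tF t2]; split=> //.
  exact: subset_trans (subsetUr _ _).
- move=> s [/eqP/cards1P[p ->]]; rewrite /z /bnd.
  rewrite (koszulD _ (fun t => c t + edge v a t)) koszulD -!/(bnd _ _) cE !edge_bnd//.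
  ring.
have := cE' [set a; u]; rewrite cards2 a_u zau => /(_ erefl) E.
have /eqP[] := insgn_neq0 a [set a; u]; rewrite {}E.
apply: big1 => w wau; have [->|/cP'[wW wF _]] := eqVneq (c' (w |: [set a; u])) 0.
  by rewrite mulr0.
have wX : w \in X.
  move: wW; rewrite subUset sub1set in_setU1 => /andP[/orP[/eqP wa|//] _].
  by move: wau; rewrite wa !inE eqxx.
have [|wu|wv] := Xa w wX.
- by apply: F_subset wF; rewrite subUset !sub1set !inE !eqxx !orbT.
- by move: wau; rewrite wu !inE eqxx orbT.
- by move: wF; rewrite (@nonface_pair_sub _ u v)// !inE ?wv ?eqxx ?orbT.
Qed.

Let clique t := forall u v, u \in t -> v \in t -> u != v -> F [set u; v].

(* Dirac's theorem: remove a non-universal vertex [a]; a component of the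
   non-neighbours of [a] is attached to the rest of [W] along a clique. *)
Lemma simplicial_vertex W S : S \subset W -> ~~ (W \subset S) -> clique S ->
  exists v, [/\ v \in W, v \notin S & clique [set x in W | (x != v) && F [set v; x]]].
Proof.
have [n] := ubnP #|W|; elim: n => // n IH in W S * => /ltnSE Wn SW WS Scl.
pose nonuniv a := [exists b in W, (a != b) && ~~ F [set a; b]].
(* The non-universal [a] is chosen adjacent to the rest of [S], so that a non-neighbour of [a] is
   outside [S]: take it in [S] if possible, otherwise anywhere. If there is none, [W] is a
   clique. *)
have [[a [aW /exists_inP[b bW /andP[ab nab]] aS]]|univ] :
    (exists a, [/\ a \in W, nonuniv a & forall x, x \in S -> x != a -> F [set a; x]]) \/
    (forall a, a \in W -> ~~ nonuniv a).
- have [/exists_inP[a aS na]|] := boolP [exists a in S, nonuniv a].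
    by left; exists a; rewrite (subsetP SW)//; split=> // s sS sa; apply: Scl; rewrite // eq_sym.
  rewrite negb_exists_in => /forall_inP Su.
  have [/exists_inP[a aW na]|] := boolP [exists a in W, nonuniv a].
    left; exists a; split=> // s sS sa; move: (Su s sS); rewrite negb_exists_in.
    by move=> /forall_inP/(_ a aW); rewrite sa negbK F_pair.
  by rewrite negb_exists_in => /forall_inP Wu; right.
- pose N := [set x in W | (x != a) && ~~ F [set a; x]].
  pose B := [set x | connect (adj_in N) b x].
  have bN : b \in N by rewrite !inE bW eq_sym ab.
  have BN x : x \in B -> x \in N.
    rewrite inE => /connectP[e]; elim/last_ind: e => [|e y _]; first by move=> _ ->.
    by rewrite rcons_path last_rcons => /andP[_ /and3P[_ yN _]] ->.
  have adjC X x y : adj_in X x y = adj_in X y x.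
    by rewrite /adj_in /adj eq_sym F_pair andbCA.
  have Bstep x y : x \in B -> y \in N -> x != y -> F [set x; y] -> y \in B.
    move=> xB yN xy Fxy; move: (xB); rewrite !inE => /connect_trans; apply.
    by apply: connect1; rewrite /adj_in (BN _ xB) yN /adj xy.
  pose S' := [set u in W | [&& u != a, F [set a; u] & [exists x in B, adj u x]]].
  have aB : a \notin B by apply/negP => /BN; rewrite !inE eqxx andbF.
  have S'cl : clique S'.
    move=> u v uS' vS' uv.
    move: (uS'); rewrite inE => /and4P[uW ua Fau /exists_inP[x xB ux]].
    move: (vS'); rewrite inE => /and4P[vW va Fav /exists_inP[y yB vy]].
    (* Among [u], [v] and [B] only [u] and [v] are adjacent to [a], and [B] connects them. *)
    apply: (@separator_clique (u |: (v |: B)) a) => //.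
    + by rewrite !inE negb_or eq_sym ua negb_or eq_sym va; move: aB; rewrite inE.
    + by rewrite setU11.
    + by rewrite !inE eqxx orbT.
    + move=> z; rewrite !in_setU1 => /or3P[/eqP->|/eqP->|]; [by left|by right|].
      by move=> /BN; rewrite inE => /and3P[_ _ /negPf->].
    set X := u |: _.
    have BX z : z \in B -> z \in X by rewrite !in_setU1 => ->; rewrite !orbT.
    have sub z z' : connect (adj_in N) b z -> adj_in N z z' -> adj_in X z z'.
      move=> bz /[dup] zz' /and3P[zN z'N adjzz']; rewrite /adj_in adjzz' andbT.
      rewrite !BX// inE //; exact: connect_trans bz (connect1 zz').
    have conn z : z \in B -> connect (adj_in X) b z.
      rewrite inE => /connectP[e]; elim/last_ind: e z => [|e z' IHe] z /=.
        by move=> _ ->; apply: connect0.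
      rewrite rcons_path last_rcons => /andP[pe ez'] ->.
      apply: connect_trans (IHe _ pe erefl) _; apply/connect1/sub => //.
      by apply/connectP; exists e.
    have symX : connect_sym (adj_in X).
      by apply: sym_connect_sym => z z'; rewrite adjC.
    apply: (connect_trans (y := x)).
      by apply: connect1; rewrite /adj_in setU11 BX.
    apply: (connect_trans (y := b)); first by rewrite symX conn.
    apply: (connect_trans (y := y)); first exact: conn.
    have vX : v \in X by rewrite /X in_setU1 in_setU1 eqxx orbT.
    by apply: connect1; rewrite adjC /adj_in vX BX.
  have WB : B :|: S' \subset W :\ a.
    apply/subsetP => x; rewrite in_setU => /orP[/BN|]; rewrite !inE.
      by case/and3P => -> ->.
    by case/and4P => -> ->.
  have BS' x : x \in B -> x \notin S'.
    by move=> /BN; rewrite !inE => /and3P[_ _ /negPf->]; rewrite /= !andbF.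
  have bB : b \in B by rewrite inE connect0.
  (* A vertex outside the clique [S'] lies in [B], and all its neighbours in [W] lie in
     [B :|: S']. *)
  have [||||v [vW' vS' vcl]] := IH (B :|: S') S'.
  + apply: leq_trans Wn; rewrite (cardsD1 a W) aW add1n ltnS.
    exact: subset_leq_card.
  + exact: subsetUr.
  + by apply/subsetPn; exists b; rewrite ?BS'// inE bB.
  + exact: S'cl.
  have vB : v \in B by move: vW'; rewrite in_setU (negPf vS') orbF.
  have vN := BN _ vB.
  move: (vN); rewrite inE => /and3P[vW va nav].
  exists v; split=> //.
    by apply: contra nav => vS; apply: aS.
  have sub x : x \in W -> x != v -> F [set v; x] -> x \in B :|: S'.
    move=> xW xv vx; have [xa|xa] := eqVneq x a.
      by move: nav; rewrite -xa F_pair vx.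
    rewrite in_setU; have [ax|nax] := boolP (F [set a; x]); last first.
      by rewrite (Bstep v)// 1?eq_sym// inE xW xa.
    apply/orP; right; rewrite inE xW xa ax; apply/exists_inP; exists v => //.
    by rewrite /adj xv F_pair.
  move=> x y; rewrite !inE => /and3P[xW xv vx] /and3P[yW yv vy].
  by apply: vcl; rewrite inE sub// ?xv ?yv.
have /subsetPn[v vW vS] := WS; exists v; split=> // x y.
rewrite !inE => /and3P[xW _ _] /and3P[yW _ _] xy.
have := univ x xW; rewrite negb_exists_in => /forall_inP/(_ y yW).
by rewrite xy negbK.
Qed.

(* A clique tree of [W], presented by the running intersection property. *)
Definition clique_tree W (Cs : seq {set 'I_r}) :=
  let C := nth set0 Cs in
  [/\ (0 < size Cs)%N,
      (forall i, i < size Cs -> C i \subset W /\ F (C i))%N,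
      (forall t, t \subset W -> F t -> exists2 i, i < size Cs & t \subset C i)%N,
      (forall i j, i < size Cs -> j < size Cs -> C i \subset C j -> i = j)%N &
      (forall j, 0 < j < size Cs -> exists2 p, p < j &
         forall i, i < j -> C i :&: C j \subset C p)%N].

(** Remove a simplicial vertex [v] with neighbours [Q]. If [Q] is a maximal clique of the rest,
    enlarge it by [v]; otherwise append [v |: Q], with a clique containing [Q] as its parent. *)
Lemma clique_tree_exists W a b : a != b -> ~~ F [set a; b] ->
  exists Cs, clique_tree W Cs.
Proof.
move=> ab nab; have cl t : clique t -> F t by move=> tc; apply: (faces_are_cliques ab nab).
have [n] := ubnP #|W|; elim: n => // n IH in W * => /ltnSE Wn.
have [->|[w wW]] := set_0Vmem W.
  exists [:: set0]; split=> //= [[|//] _|t t0 _|[|//] [|//]|[|//]]//.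
  - by rewrite sub0set (F_subset (sub0set _) (F_vertex a)).
  - by exists 0%N.
have [|||v [vW _ vcl]] := @simplicial_vertex W set0.
- exact: sub0set.
- by apply/subsetPn; exists w; rewrite ?inE.
- by move=> u v; rewrite inE.
set Q := [set x in W | _] in vcl.
have vQ : v \notin Q by rewrite inE eqxx andbF.
have FvQ : F (v |: Q).
  apply: cl => x y; rewrite !in_setU1 => /orP[/eqP->|xQ] /orP[/eqP->|yQ] xy.
  - by rewrite eqxx in xy.
  - by move: yQ; rewrite inE => /and3P[].
  - by move: xQ; rewrite inE F_pair => /and3P[].
  - exact: vcl.
have [|Cs [Cs0 CW Cmax Canti Crip]] := IH (W :\ v).
  by apply: leq_trans Wn; rewrite [in X in (_ < X)%N](cardsD1 v W) vW.
have QW : Q \subset W :\ v.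
  by apply/subsetP => x; rewrite !inE => /and3P[-> ->].
have tQ t : t \subset W -> F t -> v \in t -> t :\ v \subset Q.
  move=> tW tF vt; apply/subsetP => x; rewrite !inE => /andP[xv xt].
  rewrite xv (subsetP tW)//; apply: F_subset tF.
  by rewrite subUset !sub1set vt.
have FQ : F Q by apply: F_subset FvQ; apply: subsetUr.
have [i0 i0s QC] := Cmax Q QW FQ.
have vC i : v \notin nth set0 Cs i.
  have [/CW[/subsetP/(_ v) + _]|si] := ltnP i (size Cs); last by rewrite nth_default// inE.
  by rewrite !inE eqxx => /contra; apply.
have [QE|QE] := eqVneq Q (nth set0 Cs i0).
  have setE j : nth set0 (set_nth set0 Cs i0 (v |: Q)) j =
      if j == i0 then v |: nth set0 Cs j else nth set0 Cs j.
    by rewrite nth_set_nth /=; case: eqP => // ->; rewrite QE.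
  have subC i j : (nth set0 (set_nth set0 Cs i0 (v |: Q)) i \subset
      nth set0 (set_nth set0 Cs i0 (v |: Q)) j) -> nth set0 Cs i \subset nth set0 Cs j.
    rewrite !setE => H; apply/subsetP => x xi.
    have /(subsetP H) : x \in if i == i0 then v |: nth set0 Cs i else nth set0 Cs i.
      by case: ifP; rewrite // inE xi orbT.
    case: ifP => // _; rewrite !inE => /orP[/eqP xv|//].
    by move: (vC i); rewrite -xv xi.
  have szE : size (set_nth set0 Cs i0 (v |: Q)) = size Cs.
    by rewrite size_set_nth (maxn_idPr i0s).
  exists (set_nth set0 Cs i0 (v |: Q)); split; rewrite ?szE//.
  - move=> i si; rewrite setE; have [iW iF] := CW i si; case: eqP => [->|_].
      rewrite -QE FvQ; split=> //; rewrite subUset sub1set vW.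
      by apply: subset_trans QW _; apply: subsetDl.
    by split=> //; apply: subset_trans iW _; apply: subsetDl.
  - move=> t tW tF; have [vt|vt] := boolP (v \in t).
      exists i0 => //; rewrite setE eqxx -QE -(setD1K vt).
      by apply: setUS; apply: tQ.
    have [|i si tC] := Cmax t _ tF; first by rewrite subsetD1 tW.
    exists i => //; rewrite setE; case: ifP => // _.
    exact: subset_trans (subsetUr _ _).
  - by move=> i j si sj /subC; apply: Canti.
  move=> j /[dup] /andP[j0 sj] /Crip[p pj pP]; exists p => // i ij.
  apply: (@subset_trans _ _ (mem (nth set0 Cs p))); last first.
    by rewrite setE; case: ifP => // _; apply: subsetUr.
  apply: subset_trans (pP i ij); apply/subsetP => x; rewrite !setE !inE.
  case: eqP => [ii|_]; case: eqP => [jj|_] //.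
  - by move: ij; rewrite ii jj ltnn.
  - rewrite !inE => /andP[/orP[/eqP->|->//]].
    by rewrite (negPf (vC j)).
  - rewrite !inE => /andP[xi /orP[/eqP xv|->]]; last by rewrite xi.
    by move: xi; rewrite xv (negPf (vC i)).
have nC i : (i < size Cs)%N -> ~~ (v |: Q \subset nth set0 Cs i).
  by move=> _; apply/subsetPn; exists v; rewrite ?setU11.
have ltE i : (i < size (rcons Cs (v |: Q)))%N -> i = size Cs \/ (i < size Cs)%N.
  by rewrite size_rcons ltnS leq_eqVlt => /orP[/eqP|]; [left|right].
have nthE i : (i < size Cs)%N -> nth set0 (rcons Cs (v |: Q)) i = nth set0 Cs i.
  by move=> si; rewrite nth_rcons si.
have nthS : nth set0 (rcons Cs (v |: Q)) (size Cs) = v |: Q.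
  by rewrite nth_rcons ltnn eqxx.
exists (rcons Cs (v |: Q)); split.
- by rewrite size_rcons.
- move=> i /ltE[->|si].
    rewrite nthS FvQ; split=> //; rewrite subUset sub1set vW.
    by apply: subset_trans QW _; apply: subsetDl.
  rewrite nthE//; have [iW iF] := CW i si; split=> //.
  by apply: subset_trans iW _; apply: subsetDl.
- move=> t tW tF; have [vt|vt] := boolP (v \in t).
    exists (size Cs); rewrite ?size_rcons// nthS -(setD1K vt).
    by apply: setUS; apply: tQ.
  have [|i si tC] := Cmax t _ tF; first by rewrite subsetD1 tW.
  by exists i; rewrite ?size_rcons ?nthE// ltnS ltnW.
- move=> i j /ltE[->|si] /ltE[->|sj]//; rewrite ?nthS ?nthE//.
  + by rewrite (negPf (nC j sj)).
  + move=> iQ; have ii0 : i = i0.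
      apply: Canti => //; apply: subset_trans QC; apply/subsetP => x xi.
      have := subsetP iQ _ xi; rewrite !inE => /orP[/eqP xv|//].
      by move: (vC i); rewrite -xv xi.
    case/eqP: QE; apply/eqP; rewrite eqEsubset QC /= -ii0; apply/subsetP => x xi.
    have := subsetP iQ _ xi; rewrite in_setU1 => /orP[/eqP xv|//].
    by move: (vC i); rewrite -xv xi.
  + exact: Canti.
- move=> j /andP[j0 /ltE[jE|sj]].
    exists i0; rewrite jE// => i si; rewrite nthS !nthE//.
    apply: subset_trans QC; apply/subsetP => x; rewrite !in_setI in_setU1.
    move=> /andP[xi /orP[/eqP xv|//]].
    by move: (vC i); rewrite -xv xi.
  have [|p pj pP] := Crip j; first by rewrite j0.
  exists p => // i ij; rewrite !nthE//; [exact: pP|exact: ltn_trans pj sj|exact: ltn_trans ij sj].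
Qed.

End OneLeray.

(** * Degrees and top-degree forms *)

Section MpolyDegree.
Variables (K : fieldType) (r : nat).
Implicit Types (p q : {mpoly K[r]}) (m : 'X_{1..r}).

Lemma mcoeffMX_if p b m :
  (p * 'X_[b])@_m = if (b <= m)%MM then p@_(m - b) else 0.
Proof.
case: ifP => [bm|bm]; first by rewrite -{1}(submK bm) addmC mcoeffMX.
apply/eqP; rewrite mcoeff_eq0; apply/negP => /msuppM_le/allpairsP[[m1 m2]/= []].
by rewrite msuppX inE => _ /eqP-> E; move: bm; rewrite E lem_addl.
Qed.

Lemma msize_ltP p e : reflect (forall m, (e <= mdeg m)%N -> p@_m = 0) (msize p <= e)%N.
Proof.
apply: (iffP idP) => [pe m em|H].
  by apply: memN_msupp_eq0; apply: msize_mdeg_ge; apply: leq_trans em.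
rewrite leqNgt; apply/negP => ep.
have p0 : p != 0 by apply: contraTneq ep => ->; rewrite msize0.
have /H/eqP : (e <= mdeg (mlead p))%N by rewrite -ltnS mlead_deg.
by rewrite mleadc_eq0 (negPf p0).
Qed.

Lemma mpolyX_neq0 m : 'X_[K, m] != 0.
Proof. by rewrite -mleadc_eq0 mleadXm mcoeffX eqxx oner_neq0. Qed.

Lemma msizeXM m p : p != 0 -> msize ('X_[m] * p) = (mdeg m + msize p)%N.
Proof.
by move=> p0; rewrite msizeM ?mpolyX_neq0// msizeX.
Qed.

Lemma msizeM_leB p q : (msize (p * q) <= (msize p + msize q).-1)%N.
Proof.
have [->|p0] := eqVneq p 0; first by rewrite mul0r msize0.
have [->|q0] := eqVneq q 0; first by rewrite mulr0 msize0.
by rewrite msizeM.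
Qed.

Lemma msizeXM_le m p : (msize ('X_[m] * p) <= mdeg m + msize p)%N.
Proof.
by have [->|p0] := eqVneq p 0; [rewrite mulr0 msize0|rewrite msizeXM].
Qed.

(** As [msize] is one more than the degree, for [m0] of degree [e] this says that the top form of
    [p] is the monomial [m0] itself. *)
Definition leading_mon e (m0 : 'X_{1..r}) p :=
  (msize p <= e.+1)%N /\ forall m, mdeg m = e -> p@_m = (m == m0)%:R.

Lemma leading_monM e m0 p E a m : leading_mon e m0 p -> mdeg m0 = e -> (msize a <= E.+1)%N ->
  mdeg m = (E + e)%N -> (a * p)@_m = if (m0 <= m)%MM then a@_(m - m0) else 0.
Proof.
move=> [pe ptop] m0e aE mE; rewrite -[p](subrK 'X_[m0]) mulrDr mcoeffD mcoeffMX_if.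
suff -> : (a * (p - 'X_[m0]))@_m = 0 by rewrite add0r.
have pm : (msize (p - 'X_[m0]) <= e)%N.
  apply/msize_ltP => m' em'; rewrite mcoeffB mcoeffX.
  have [/esym/ptop->|ne] := eqVneq e (mdeg m'); first by rewrite eq_sym subrr.
  move/msize_ltP: pe => ->; last by rewrite ltn_neqAle ne.
  by case: eqP => [m0m|]; rewrite ?subrr//; move: ne; rewrite -m0m m0e eqxx.
have : (msize (a * (p - 'X_[m0])) <= E + e)%N.
  apply: leq_trans (msizeM_leB _ _) _; rewrite -subn1 leq_subLR add1n -addSn.
  exact: leq_add.
by move/msize_ltP; apply; rewrite mE.
Qed.

End MpolyDegree.

(** * Monomial generators and syzygies of a clique tree *)

Section CliqueTreeIdeal.
Variables (r n d : nat) (C : nat -> {set 'I_r}) (par : nat -> nat).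
Hypothesis par_lt : forall j, (0 < j <= n)%N -> (par j < j)%N.
Hypothesis par_inter : forall i j, (i < j <= n)%N -> C i :&: C j \subset C (par j).
Hypothesis C_card : forall j, (j <= n)%N -> #|~: C j| = d.
Hypothesis C_anti : forall i j, (i <= n)%N -> (j <= n)%N -> C i \subset C j -> i = j.
Hypothesis C_cover : forall v, exists2 j, (j <= n)%N & v \in C j.

Local Notation g j := (sqfree_mon (~: C j)).
Local Notation mA j := (sqfree_mon (C j :\: C (par j))).
Local Notation mB j := (sqfree_mon (C (par j) :\: C j)).

Lemma mdeg_g j : (j <= n)%N -> mdeg (g j) = d.
Proof. by move=> /C_card; rewrite mdeg_sqfree_mon. Qed.

(** Both sides are the least common multiple of the two generators, the product of the variables
    outside [C j :&: C (par j)]. *)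
Lemma clique_syzygy j : (mA j + g j = mB j + g (par j))%MM.
Proof.
rewrite -!sqfree_monU; first by congr sqfree_mon; apply/setP => x; rewrite !inE;
  case: (x \in C j); case: (x \in C (par j)).
- by apply/pred0P => x /=; rewrite !inE; case: (x \in C j); case: (x \in C (par j)).
- by apply/pred0P => x /=; rewrite !inE; case: (x \in C j); case: (x \in C (par j)).
Qed.

Let par_n j : (0 < j <= n)%N -> (par j <= n)%N.
Proof. by move=> /[dup] /par_lt /ltnW pj /andP[_]; apply: leq_trans. Qed.

Lemma mdeg_mB j : (0 < j <= n)%N -> mdeg (mB j) = mdeg (mA j).
Proof.
move=> jn; have := congr1 mdeg (clique_syzygy j); rewrite !mdegD !mdeg_g ?par_n//.
  by move/addIn.
by case/andP: jn.
Qed.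

Lemma mdeg_mA_gt0 j : (0 < j <= n)%N -> (0 < mdeg (mA j))%N.
Proof.
move=> jn; rewrite mdeg_sqfree_mon card_gt0; apply/eqP => /eqP.
rewrite setD_eq0 => /C_anti E; have := par_lt jn; rewrite -E ?ltnn//.
  by case/andP: jn.
exact: par_n.
Qed.

(** The degree bound for the [j]-th term of the recursion. *)
Let E j := (\sum_(1 <= i < j) mdeg (mA i))%N.

Let E_S j : (0 < j)%N -> E j.+1 = (E j + mdeg (mA j))%N.
Proof. by move=> j0; rewrite /E big_nat_recr. Qed.

Let E_mono i j : (i <= j)%N -> (E i <= E j)%N.
Proof.
move=> ij; rewrite /E; have [i0|i0] := posnP i; first by rewrite i0 big_geq.
by rewrite (big_cat_nat i0 ij)//= leq_addr.
Qed.

Let E_lt i j : (0 < i)%N -> (i < j)%N -> (j <= n.+1)%N -> (E i < E j)%N.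
Proof.
move=> i0 ij jn; apply: leq_trans (E_mono ij); rewrite E_S// -addn1 leq_add2l.
by apply: mdeg_mA_gt0; rewrite i0; lia.
Qed.

(** A variable outside [C 0] is counted once, at the first clique containing it: for any later one,
    running intersection puts it in the parent too. *)
Lemma sum_mA : (\sum_(1 <= i < n.+1) mA i = g 0)%MM.
Proof.
apply/mnmP => v; rewrite mnm_sumE sqfree_monE inE.
have vex : exists j, v \in C j by have [j _] := C_cover v; exists j.
have [f vf fmin] := ex_minnP vex.
have fn : (f <= n)%N by have [j jn /fmin] := C_cover v; move/leq_trans; apply.
have E1 i : (0 < i <= n)%N -> mA i v = (i == f) :> nat.
  move=> /andP[i0 iN]; rewrite sqfree_monE !inE.
  case: (ltngtP i f) => [lt_if|lt_fi|iE].
  - by case: (boolP (v \in C i)) => [/fmin|]; [rewrite leqNgt lt_if|rewrite andbF].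
  - case: (boolP (v \in C i)) => [vi|]; last by rewrite andbF.
    by rewrite (subsetP (@par_inter f i _)) ?lt_fi// inE vf vi.
  rewrite iE vf andbT; case: (boolP (v \in C (par f))) => [/fmin|//].
  by rewrite leqNgt par_lt// -iE i0.
rewrite big_nat_cond (eq_bigr (fun i => (i == f) : nat)); last first.
  by move=> i; rewrite andbT => /E1.
rewrite -big_nat_cond; have [f0|f0] := posnP f.
  have -> : v \in C 0%N by rewrite -f0.
  rewrite big_nat big1// => i /andP[i1 _]; case: eqP => // iE.
  by move: i1; rewrite iE f0.
have -> : v \notin C 0%N by apply/negP => /fmin; rewrite leqNgt f0.
rewrite (big_cat_nat f0 (leqW fn))/= big_nat big1 => [|i /andP[_ lif]]; last first.
  by rewrite ltn_eqF.
rewrite add0n big_ltn ?ltnS// eqxx big_nat big1// => i /andP[lfi _].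
by rewrite gtn_eqF.
Qed.

Let E_total : E n.+1 = d.
Proof. by rewrite -(mdeg_g (leq0n n)) -sum_mA mdeg_sum. Qed.

Lemma d_gt0 : (0 < n)%N -> (0 < d)%N.
Proof. by move=> n0; rewrite -E_total; apply: leq_ltn_trans (@E_lt 1 n.+1 _ _ _) => //; lia. Qed.

Section Recursion.
Variable k : fieldType.
Implicit Type h : nat -> {mpoly k[r]}.

Definition syzygy_rec h :=
  forall j, (0 < j)%N -> h j.+1 = 'X_[mA j] * h j - 'X_[mB j] * h (par j).

Lemma syzygy_rec_exists (u0 u1 : {mpoly k[r]}) : (forall j, par j <= j)%N ->
  exists h, [/\ h 0%N = u0, h 1%N = u1 & syzygy_rec h].
Proof.
(* The values form a growing list, since [par j] may point to any earlier index; [L m] holds the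
   first [m.+2] of them. *)
move=> par_le; pose next (s : seq {mpoly k[r]}) :=
  let j := (size s).-1 in 'X_[mA j] * s`_j - 'X_[mB j] * s`_(par j).
pose L m := iter m (fun s => rcons s (next s)) [:: u0; u1].
have sL m : size (L m) = m.+2 by elim: m => //= m IH; rewrite size_rcons IH.
have LS m j : (j <= m.+1)%N -> (L m.+1)`_j = (L m)`_j.
  by move=> jm; rewrite /= nth_rcons sL ltnS jm.
have LE m m' j : (j <= m.+1)%N -> (m <= m')%N -> (L m')`_j = (L m)`_j.
  move=> jm /subnK <-; elim: (m' - m)%N => // i IH.
  by rewrite addSn LS ?IH// (leq_trans jm)// ltnS leq_addl.
exists (fun j => (L j)`_j); split=> // -[//|j] _.
rewrite (LE j.+1 j.+2)// {1}/L iterS -/(L j) nth_rcons sL ltnn eqxx /next sL [j.+2.-1]/=.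
rewrite (LE j j.+1 j.+1)//; congr (_ - _ * _).
have pj := par_le j.+1; have [pj'|pj'] := leqP (par j.+1) j; first by rewrite (LE (par j.+1) j).
have -> : par j.+1 = j.+1 by apply/eqP; rewrite eqn_leq pj.
by rewrite (LE j j.+1).
Qed.

Let syzygy_rec_msize h : syzygy_rec h -> (msize (h 0%N) <= 1)%N -> (msize (h 1%N) <= 1)%N ->
  forall j, (j <= n.+1)%N -> (msize (h j) <= (E j).+1)%N.
Proof.
move=> hrec h0 h1; elim/ltn_ind => -[|[|j]] IH jn; rewrite ?/(E 0) ?/(E 1) ?big_geq//.
have jn' : (0 < j.+1 <= n)%N by [].
rewrite hrec//; apply: leq_trans (msizeD_le _ _) _; rewrite msizeN geq_max E_S// addnC -addnS.
apply/andP; split; apply: leq_trans (msizeXM_le _ _) _.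
  by rewrite leq_add2l IH// ltnW.
rewrite mdeg_mB// leq_add2l; have pj := par_lt jn'.
apply: leq_trans (IH _ _ _) _; first exact: ltnW.
  by apply: ltnW; apply: leq_trans pj _; apply: ltnW.
by rewrite ltnS E_mono// ltnW.
Qed.

Lemma syzygy_rec_msize_last h :
  syzygy_rec h -> (msize (h 0%N) <= 1)%N -> (msize (h 1%N) <= 1)%N ->
  (msize (h n.+1) <= d.+1)%N.
Proof. by move=> hrec h0 h1; rewrite -E_total; apply: syzygy_rec_msize. Qed.

(** The term with [mB j] has smaller degree, or is 0 when [par j = 0]; so the top form is the
    product of the [mA j], which is [g 0] by [sum_mA]. *)
Lemma syzygy_rec_leading h : syzygy_rec h -> h 0%N = 0 -> h 1%N = 1 ->
  leading_mon d (g 0) (h n.+1).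
Proof.
move=> hrec h0 h1.
have hsz : forall j, (j <= n.+1)%N -> (msize (h j) <= (E j).+1)%N.
  by apply: syzygy_rec_msize; rewrite ?h0 ?h1 ?msize0 ?msize1.
suff H : forall j, (j <= n)%N -> leading_mon (E j.+1) (\sum_(1 <= i < j.+1) mA i)%MM (h j.+1).
  by have := H n (leqnn n); rewrite sum_mA E_total.
elim=> [_|j IH jn]; split; rewrite ?hsz//.
  move=> m; rewrite /E !big_geq// h1 => /eqP; rewrite mdeg_eq0 => /eqP->.
  by rewrite mcoeff1 eqxx.
have [_ top] := IH (ltnW jn).
have jn' : (0 < j.+1 <= n)%N by [].
move=> m; rewrite E_S// hrec// mcoeffB => mE.
have -> : ('X_[mB j.+1] * h (par j.+1))@_m = 0.
  have [->|pj0] := posnP (par j.+1); first by rewrite h0 mulr0 mcoeff0.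
  suff /msize_ltP : (msize ('X_[mB j.+1] * h (par j.+1)) <= mdeg m)%N by apply.
  rewrite mE addnC; apply: leq_trans (msizeXM_le _ _) _; rewrite mdeg_mB// leq_add2l.
  apply: leq_trans (hsz _ _) _; last by apply: E_lt; rewrite ?par_lt// ltnW.
  by apply: leqW; apply: par_n.
rewrite subr0 mulrC mcoeffMX_if big_nat_recr//=.
case: ifP => [am|am].
  rewrite top; last first.
    by have := congr1 mdeg (submK am); rewrite mdegD mE => /addIn.
  by rewrite -(eqm_add2r (mA j.+1)) submK.
by case: eqP => // mm; move: am; rewrite mm lem_addl.
Qed.

End Recursion.

(** * Leading forms of the deformed ideal *)

Section LiftedGenerators.
Variables (K : fieldType) (f : nat -> {mpoly K[r]}) (c0 c1 : K).
Hypothesis n_gt0 : (0 < n)%N.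
Hypothesis f_rec : syzygy_rec f.
Hypothesis f_last : f n.+1 = c0 *: f 0%N + c1 *: f 1%N.
Hypothesis f0_lead : leading_mon d (g 0) (f 0%N).
Hypothesis f1_size : (msize (f 1%N) <= d.+1)%N.

Let f_last_size D : (d <= D)%N -> (msize (f n.+1) <= D.+1)%N.
Proof.
move=> dD; have [f0s _] := f0_lead; rewrite f_last.
apply: leq_trans (msizeD_le _ _) _; rewrite geq_max; apply/andP; split.
  by apply: leq_trans (msizeZ_le _ _) _; apply: leq_trans f0s _.
by apply: leq_trans (msizeZ_le _ _) _; apply: leq_trans f1_size _.
Qed.

(* The entries of column [j] of the syzygy matrix have positive degree, so any
   common degree bound above [d] can be lowered. *)
Let f_size j : (j <= n.+1)%N -> (msize (f j) <= d.+1)%N.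
Proof.
rewrite leq_eqVlt => /orP[/eqP->|]; first exact: f_last_size.
suff H D : (d <= D)%N -> (forall i, (i <= n)%N -> (msize (f i) <= D.+1)%N) ->
    forall i, (i <= n)%N -> (msize (f i) <= d.+1)%N.
  rewrite ltnS; apply: (H (d + \max_(i < n.+1) msize (f i))%N); first exact: leq_addr.
  move=> i iN; apply: leqW; apply: leq_trans (leq_addl _ _).
  by have := @leq_bigmax _ (fun i : 'I_n.+1 => msize (f i)) (Ordinal (iN : (i < n.+1)%N)).
move=> /subnK <-; elim: (D - d)%N => // D' IH H; apply: IH.
elim/ltn_ind => -[|[|i]] IHi iN.
- by have [f0s _] := f0_lead; apply: leq_trans f0s _; rewrite ltnS leq_addl.
- by apply: leq_trans f1_size _; rewrite ltnS leq_addl.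
have [->|fi0] := eqVneq (f i.+2) 0; first by rewrite msize0.
have i2 : (0 < i.+2 <= n)%N by [].
rewrite -(leq_add2l (mdeg (mA i.+2))) -msizeXM//.
have -> : 'X_[mA i.+2] * f i.+2 = f i.+3 + 'X_[mB i.+2] * f (par i.+2).
  by rewrite (f_rec (ltn0Sn i.+1)) subrK.
apply: leq_trans (msizeD_le _ _) _; rewrite geq_max; apply/andP; split.
  have: (msize (f i.+3) <= (D'.+1 + d).+1)%N.
    have [iN'|] := leqP i.+3 n; first exact: H.
    move=> iN'; have -> : i.+3 = n.+1 by apply/eqP; rewrite eqn_leq; apply/andP; split.
    by apply: f_last_size; apply: leq_addl.
  by have := mdeg_mA_gt0 i2; lia.
apply: leq_trans (msizeXM_le _ _) _; rewrite mdeg_mB// leq_add2l.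
by apply: IHi; [apply: par_lt|apply: par_n].
Qed.

(** In [A_j f_j = f_(j+1) + B_j f_(p j)] the term [f_(j+1)] has degree at most [d], below the top
    degree; so the top form is [B_j g_(p j) = A_j g_j], and [A_j] cancels. *)
Lemma lifted_leading j : (j <= n)%N -> leading_mon d (g j) (f j).
Proof.
elim/ltn_ind: j => -[|j] IH jn //; split; first by apply: f_size; apply: leqW.
have j1 : (0 < j.+1 <= n)%N by [].
move=> m md; have [_ ptop] := IH _ (par_lt j1) (par_n j1).
have /(congr1 (mcoeff (mA j.+1 + m)%MM)) : 'X_[mA j.+1] * f j.+1 =
    f j.+2 + 'X_[mB j.+1] * f (par j.+1) by rewrite (f_rec (ltn0Sn j)) subrK.
rewrite mulrC mcoeffMX mcoeffD => ->.
have /msize_ltP-> : (msize (f j.+2) <= d.+1)%N by apply: f_size.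
  rewrite add0r mulrC mcoeffMX_if; case: ifP => [bm|bm].
    rewrite ptop; last first.
      have := congr1 mdeg (submK bm); rewrite !mdegD mdeg_mB// md addnC.
      by move/addnI.
    have := eqm_add2r (mB j.+1) (mA j.+1 + m - mB j.+1) (g (par j.+1)).
    rewrite submK// [(g _ + _)%MM]addmC -clique_syzygy eqm_add2l.
    by move=> ->.
  by case: eqP => // mg; move: bm; rewrite mg clique_syzygy lem_addr.
by rewrite mdegD md addnC -addn1 leq_add2l mdeg_mA_gt0.
Qed.

(** The value is [n.+1] if no generator divides [m]. *)
Let idx m := find (fun j => (g j <= m)%MM) (iota 0 n.+1).

Let idxP m : (idx m <= n)%N -> (g (idx m) <= m)%MM.
Proof.
move=> im; have h : has (fun j => (g j <= m)%MM) (iota 0 n.+1).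
  by rewrite has_find size_iota ltnS.
by have := nth_find 0%N h; rewrite nth_iota// ltnS.
Qed.

Let idx_min m j : (j <= n)%N -> (g j <= m)%MM -> (idx m <= j)%N.
Proof.
move=> jn gm; rewrite leqNgt; apply/negP => /(before_find 0%N).
by rewrite nth_iota// gm.
Qed.

(* Representations in which every monomial is produced by the first generator
   dividing it; leading monomials cannot cancel in such a sum. *)
Let standard q := exists2 a : 'I_n.+1 -> {mpoly K[r]},
  forall i t, t \in msupp (a i) -> idx (t + g i)%MM = i &
  q = \sum_i a i * f i.

Let standard0 : standard 0.
Proof. by exists (fun=> 0) => [i t|]; rewrite ?msupp0// big1// => i _; rewrite mul0r. Qed.

Let standardD q1 q2 : standard q1 -> standard q2 -> standard (q1 + q2).
Proof.
move=> [a aP ->] [b bP ->]; exists (fun i => a i + b i).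
  by move=> i t /msuppD_le; rewrite mem_cat => /orP[/aP|/bP].
by rewrite -big_split; apply: eq_bigr => i _; rewrite mulrDl.
Qed.

Let standardZ c q : standard q -> standard (c *: q).
Proof.
move=> [a aP ->]; exists (fun i => c *: a i).
  by move=> i t /msuppZ_le/aP.
by rewrite scaler_sumr; apply: eq_bigr => i _; rewrite scalerAl.
Qed.

(** Induction on the degree of [t], then on [j]. If an earlier [g i] divides [t + g j], running
    intersection makes [g (par j)] divide it, hence [mA j] divides [t]. The recursion then trades
    [f j] for [f j.+1] with a cofactor of lower degree and for [f (par j)] with one of equal
    degree. *)
Let standardX t j : (j <= n)%N -> standard ('X_[t] * f j).
Proof.
have [e] := ubnP (mdeg t); elim: e => // e IHe in t j *; rewrite ltnS => te.
elim/ltn_ind: j t te => j IHj t te jn.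
have := idx_min jn (lem_addl t (g j)); rewrite leq_eqVlt => /orP[/eqP ij|ij].
  exists (fun i : 'I_n.+1 => if i == j :> nat then 'X_[t] else 0).
    move=> i t'; case: eqP => [ijE|_]; last by rewrite msupp0.
    by rewrite msuppX inE => /eqP->; rewrite ijE.
  have jn1 : (j < n.+1)%N by [].
  rewrite (bigD1 (Ordinal jn1))//= eqxx big1 ?addr0// => i.
  by rewrite -val_eqE /= => /negPf->; rewrite mul0r.
set m := (t + g j)%MM in ij; set i := idx m in ij.
have iN : (i <= n)%N by apply: ltnW; apply: leq_trans jn.
have j1 : (0 < j <= n)%N by rewrite jn andbT; apply: leq_ltn_trans ij.
have gi : (g i <= m)%MM := idxP iN.
have gp : (g (par j) <= m)%MM.
  rewrite sqfree_mon_le; apply/subsetP => v; rewrite inE => vp.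
  have : (v \notin C i) || (v \notin C j).
    rewrite -negb_and; apply: contra vp => vij.
    by apply: (subsetP (par_inter _)) (_ : v \in C i :&: C j); rewrite ?ij// inE.
  move: gi; rewrite sqfree_mon_le => /subsetP gi.
  case/orP => [vi|vj]; first by apply: gi; rewrite inE.
  by rewrite inE mnmDE sqfree_monE inE vj addn1.
have At : (mA j <= t)%MM.
  apply/mnm_lepP => v; rewrite sqfree_monE !inE.
  have := mnm_lepP gp v; rewrite mnmDE !sqfree_monE !inE.
  by case: (v \in C j); case: (v \in C (par j)); rewrite ?addn0.
have -> : 'X_[t] * f j = 'X_[t - mA j] * f j.+1 + 'X_[t - mA j + mB j] * f (par j).
  have j0 : (0 < j)%N by case/andP: j1.
  rewrite -{1}(submK At) !mpolyXD (f_rec j0); ring.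
have mt := congr1 mdeg (submK At); rewrite mdegD in mt.
have lt_t : (mdeg (t - mA j) < e)%N by have := mdeg_mA_gt0 j1; lia.
apply: standardD; last first.
  by apply: IHj; [exact: par_lt|rewrite mdegD mdeg_mB// mt|exact: par_n].
have [jn'|nj] := leqP j.+1 n; first exact: IHe.
(* At [j = n] the recursion leaves the list of generators, and [f_last] leads back to [f 0] and
   [f 1]. *)
have -> : f j.+1 = c0 *: f 0%N + c1 *: f 1%N.
  by rewrite -f_last; congr f; apply/eqP; rewrite eqSS eqn_leq jn.
rewrite mulrDr -!scalerAr.
by apply: standardD; apply: standardZ; apply: IHe.
Qed.

Let standard_ideal u v : standard (u * f 0%N + v * f 1%N).
Proof.
suff H w j : (j <= n)%N -> standard (w * f j) by apply: standardD; apply: H.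
move=> jn; rewrite [w]mpolyE mulr_suml; elim/big_rec: _ => [|m q _]; first exact: standard0.
by apply: standardD; rewrite -scalerAl; apply/standardZ/standardX.
Qed.

(** In a standard representation [t + g i] determines [i] and [t], so top forms of the summands
    cannot cancel, and the top form of [q] lies in the ideal of the [g j]. *)
Lemma lifted_top_monomials u v m (q := u * f 0%N + v * f 1%N) :
  q@_m != 0 -> (msize q <= (mdeg m).+1)%N -> exists2 j, (j <= n)%N & (g j <= m)%MM.
Proof.
have [a aP qE] : standard q by exact: standard_ideal.
move=> qm qsz.
pose M := \max_i msize (a i).
have aM i : (msize (a i) <= M)%N by exact: (@leq_bigmax _ (fun i => msize (a i))).
have [i0 i0M] : exists i0, msize (a i0) = M.
  by have [|i0 iE] := @eq_bigmax _ (fun i => msize (a i)); [rewrite card_ord|exists i0].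
have a0 : a i0 != 0.
  apply: contraNneq qm => ai0; rewrite qE big1 ?mcoeff0// => i _.
  suff -> : a i = 0 by rewrite mul0r.
  by apply/eqP; rewrite -msize_poly_eq0 -leqn0 (leq_trans (aM i))// -i0M ai0 msize0.
pose t0 := mlead (a i0); have t0E := mlead_deg a0; rewrite -/t0 i0M in t0E.
have aT i : (msize (a i) <= (mdeg t0).+1)%N by rewrite t0E.
have topE m' : mdeg m' = (mdeg t0 + d)%N -> q@_m' =
    \sum_(i < n.+1) if (g i <= m')%MM then (a i)@_(m' - g i) else 0.
  move=> mE; rewrite qE raddf_sum /=; apply: eq_bigr => i _.
  have iN : (i <= n)%N by rewrite -ltnS.
  exact: (leading_monM (lifted_leading iN) (mdeg_g iN) (aT i) mE).
have i0N : (i0 <= n)%N by rewrite -ltnS.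
have m0E : mdeg (t0 + g i0)%MM = (mdeg t0 + d)%N by rewrite mdegD mdeg_g.
have q0 : q@_(t0 + g i0)%MM != 0.
  rewrite topE// (bigD1 i0)//= lem_addl addmK big1 => [|i ii0].
    by rewrite addr0 -mcoeff_msupp mlead_supp.
  case: ifP => // gi; apply: contraNeq ii0; rewrite -mcoeff_msupp => /aP.
  rewrite submK// (aP i0) => [/val_inj ->//|].
  exact: mlead_supp.
(* The surviving coefficient at [t0 + g i0] fixes the degree of [q]. *)
have md : mdeg m = (mdeg t0 + d)%N.
  apply/eqP; rewrite eqn_leq; apply/andP; split.
    rewrite leqNgt; apply/negP => lt_m; case/eqP: qm.
    suff /msize_ltP : (msize q <= (mdeg t0 + d).+1)%N by apply.
    rewrite qE; apply: leq_trans (msize_sum _ _ _) _; apply/bigmax_leqP => i _.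
    apply: leq_trans (msizeM_leB _ _) _; have iN : (i <= n)%N by rewrite -ltnS.
    by have := f_size (leqW iN); have := aT i; lia.
  rewrite leqNgt; apply/negP => lt_m; case/eqP: q0.
  by move/msize_ltP: qsz; apply; rewrite m0E.
have [i gi] : exists i : 'I_n.+1, (g i <= m)%MM.
  apply/existsP; apply: contraR qm => /existsPn ng; rewrite topE// big1// => i _.
  by rewrite (negPf (ng i)).
by exists i => //; rewrite -ltnS.
Qed.

End LiftedGenerators.
End CliqueTreeIdeal.

(** * The generic fibre of a polynomial map *)

Lemma frac_denominator (T : idomainType) (x : {fraction T}) :
  exists n d, d != 0 /\ @FracField.tofrac T d * x = FracField.tofrac n.
Proof.
elim/quotW: x => x; exists (frac x).1, (frac x).2; split; first exact: denom_ratioP.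
have d0 := denom_ratioP x.
rewrite !piE; apply/eqmodP; rewrite /= FracField.equivfE /FracField.mulf.
by rewrite !numden_Ratio ?oner_neq0 ?mul1r ?mulr1// mulrC.
Qed.

Section GenericFibre.
Variables (k : fieldType) (r N : nat) (a : 'I_N -> {mpoly k[r]}).

(* [T] stands for [k[t_1, .., t_N]], [K] for its fraction field and [spec0]
   for the specialization [t_i := a i]. *)
Variables (T : idomainType) (K : fieldType).
Variables (frac : {rmorphism T -> K}) (const : {rmorphism k -> T}) (t : 'I_N -> T).
Variable (spec0 : {rmorphism T -> {mpoly k[r]}}).
Hypothesis frac_inj : injective frac.
Hypothesis frac_denom : forall x, exists n d, d != 0 /\ frac d * x = frac n.
Hypothesis T_ind : forall Q : T -> Prop,
  (forall c, Q (const c)) -> (forall i, Q (t i)) ->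
  (forall c d, Q c -> Q d -> Q (c + d)) -> (forall c d, Q c -> Q d -> Q (c * d)) ->
  forall c, Q c.
Hypothesis spec0_const : forall c, spec0 (const c) = c%:MP.
Hypothesis spec0_t : forall i, spec0 (t i) = a i.

Definition fibre_gen i : {mpoly K[r]} :=
  map_mpoly (frac \o const) (a i) - (frac (t i))%:MP.

Let J := ideal_gen (fun g => exists i, g = fibre_gen i).

Let toK : {mpoly T[r]} -> {mpoly K[r]} := map_mpoly frac.
Let inc : {mpoly k[r]} -> {mpoly T[r]} := map_mpoly const.
Let spec : {mpoly T[r]} -> {mpoly k[r]} := mmap spec0 (fun i => 'X_i).

Let toKD : {morph toK : p q / p + q}.
Proof. by move=> p q; rewrite /toK rmorphD. Qed.
Let toKB : {morph toK : p q / p - q}.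
Proof. by move=> p q; rewrite /toK rmorphB. Qed.
Let toKM : {morph toK : p q / p * q}.
Proof. by move=> p q; rewrite /toK rmorphM. Qed.
Let incD : {morph inc : p q / p + q}.
Proof. by move=> p q; rewrite /inc rmorphD. Qed.
Let incM : {morph inc : p q / p * q}.
Proof. by move=> p q; rewrite /inc rmorphM. Qed.
Let specD : {morph spec : p q / p + q}.
Proof. by move=> p q; rewrite /spec rmorphD. Qed.
Let specB : {morph spec : p q / p - q}.
Proof. by move=> p q; rewrite /spec rmorphB. Qed.
Let specM : {morph spec : p q / p * q}.
Proof. by move=> p q; rewrite /spec rmorphM. Qed.
Let toK0 : toK 0 = 0.
Proof. by rewrite /toK rmorph0. Qed.
Let inc0 : inc 0 = 0.
Proof. by rewrite /inc rmorph0. Qed.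
Let spec_0 : spec 0 = 0.
Proof. by rewrite /spec rmorph0. Qed.
Let toKC c : toK c%:MP = (frac c)%:MP.
Proof. exact: map_mpolyC. Qed.
Let incC c : inc c%:MP = (const c)%:MP.
Proof. exact: map_mpolyC. Qed.
Let specC c : spec c%:MP = spec0 c.
Proof. exact: mmapC. Qed.
Let toKX i : toK 'X_i = 'X_i.
Proof. exact: map_mpolyX. Qed.
Let incX i : inc 'X_i = 'X_i.
Proof. exact: map_mpolyX. Qed.
Let specX i : spec 'X_i = 'X_i.
Proof. by rewrite /spec mmapX mmap1U. Qed.

Let toKE p m : (toK p)@_m = frac p@_m.
Proof. exact: mcoeff_map_mpoly. Qed.

Let toK_inc p : toK (inc p) = map_mpoly (frac \o const) p.
Proof.
apply/mpolyP => m; rewrite toKE [RHS]mcoeff_map_mpoly; congr (frac _).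
exact: mcoeff_map_mpoly.
Qed.

Let toK_inj : injective toK.
Proof.
move=> p q /mpolyP E; apply/mpolyP => m; apply: frac_inj.
by have := E m; rewrite [LHS]toKE [RHS]toKE.
Qed.

Let spec_inc p : spec (inc p) = p.
Proof.
elim/mpoly_ring_ind: p => [c|i|p q IHp IHq|p q IHp IHq].
- by rewrite incC specC spec0_const.
- by rewrite incX specX.
- by rewrite incD specD IHp IHq.
- by rewrite incM specM IHp IHq.
Qed.

(** Modulo [J] each [t i] equals [a i], so the substitution changes nothing. *)
Let J_spec h : J (toK h - toK (inc (spec h))).
Proof.
have JM p q : J (toK p - toK (inc (spec p))) -> J (toK q - toK (inc (spec q))) ->
    J (toK (p * q) - toK (inc (spec (p * q)))).
  by move=> Jp Jq; rewrite specM incM 2!toKM; exact: (ideal_genBM Jp Jq).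
have JD p q : J (toK p - toK (inc (spec p))) -> J (toK q - toK (inc (spec q))) ->
    J (toK (p + q) - toK (inc (spec (p + q)))).
  by move=> Jp Jq; rewrite specD incD 2!toKD opprD addrACA; exact: (ideal_genD Jp Jq).
elim/mpoly_ring_ind: h => [c|i|p q|p q]; [|by rewrite specX incX subrr; apply: ideal_gen0|exact: JD|exact: JM].
elim/T_ind: c => [c|i|c d|c d].
- by rewrite specC spec0_const incC subrr; apply: ideal_gen0.
- rewrite specC spec0_t toK_inc toKC -opprB.
  by apply/ideal_genN/ideal_gen_mem; exists i.
- by rewrite mpolyCD; apply: JD.
- by rewrite mpolyCM; apply: JM.
Qed.

Hypothesis J_proper : ~ J 1.

Let unitK c (p : {mpoly K[r]}) : c != 0 -> J ((frac c)%:MP * p) -> J p.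
Proof.
move=> c0 /(ideal_genM (frac c)^-1%:MP); rewrite mulrA -mpolyCM mulVf ?mul1r//.
by rewrite -(rmorph0 frac) (inj_eq frac_inj).
Qed.

(** A nonzero [c] becomes a unit of [K]; if it specialized to 0, [J_spec] would put this unit in
    [J]. Properness of [J] thus makes [spec0] injective. *)
Let spec0_neq0 c : c != 0 -> spec0 c != 0.
Proof.
move=> c0; apply/eqP => sc0; apply: J_proper; apply: (unitK c0).
by have := J_spec c%:MP; rewrite specC sc0 inc0 toK0 subr0 toKC mulr1.
Qed.

Let fracCM c d : (frac (c * d))%:MP = (frac c)%:MP * (frac d)%:MP :> {mpoly K[r]}.
Proof. by rewrite rmorphM mpolyCM. Qed.

Let clear_denominators (p : {mpoly K[r]}) :
  exists c h, c != 0 /\ (frac c)%:MP * p = toK h.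
Proof.
elim/mpoly_ring_ind: p => [x|i|p q [c [g [c0 cE]]] [d [h [d0 dE]]]|p q [c [g [c0 cE]]] [d [h [d0 dE]]]].
- have [n [d [d0 E]]] := frac_denom x; exists d, n%:MP; split=> //.
  by rewrite -mpolyCM E toKC.
- by exists 1, 'X_i; rewrite oner_neq0 rmorph1 mul1r toKX.
- exists (c * d), (d%:MP * g + c%:MP * h); rewrite mulf_neq0//; split=> //.
  rewrite toKD 2!toKM 2!toKC -cE -dE !fracCM.
  by move: (frac c)%:MP (frac d)%:MP => x y; ring.
- exists (c * d), (g * h); rewrite mulf_neq0//; split=> //.
  rewrite toKM -cE -dE !fracCM.
  by move: (frac c)%:MP (frac d)%:MP => x y; ring.
Qed.

(** Membership in [J] tested after clearing denominators, which moves primality to the domain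
    [{mpoly k[r]}]. *)
Let P p := exists c h, [/\ c != 0, (frac c)%:MP * p = toK h & spec h = 0].

Let P_J p : P p -> J p.
Proof.
move=> [c [h [c0 E sh]]]; apply: (unitK c0); rewrite E.
by have := J_spec h; rewrite sh inc0 toK0 subr0.
Qed.

Let P_comb b u v : P u -> P v -> P (b * u + v).
Proof.
move=> [c [g [c0 cE sg]]] [d [h [d0 dE sh]]]; have [e [f [e0 eE]]] := clear_denominators b.
exists (e * c * d), (d%:MP * f * g + (e * c)%:MP * h); rewrite !mulf_neq0//; split=> //.
  rewrite toKD 3!toKM 2!toKC -cE -dE -eE !fracCM.
  by move: (frac c)%:MP (frac d)%:MP (frac e)%:MP => x y z; ring.
by rewrite specD !specM sg sh !mulr0 addr0.
Qed.

Let P0 : P 0.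
Proof. by exists 1, 0; rewrite oner_neq0 mulr0 toK0 spec_0. Qed.

Let J_P p : J p -> P p.
Proof.
elim/ideal_gen_ind => [|u v Pu Pv|b _ [i ->]]; first exact: P0.
  by rewrite -[u]mul1r; apply: P_comb.
rewrite -[_ * _]addr0; apply: P_comb P0.
exists 1, (inc (a i) - (t i)%:MP); rewrite oner_neq0 rmorph1 mul1r toKB toKC toK_inc.
by split=> //; rewrite specB spec_inc specC spec0_t subrr.
Qed.

Let P_prime p q : P (p * q) -> P p \/ P q.
Proof.
move=> [e [f [e0 eE sf]]].
have [c [g [c0 cE]]] := clear_denominators p; have [d [h [d0 dE]]] := clear_denominators q.
have E : e%:MP * (g * h) = (c * d)%:MP * f.
  apply: toK_inj; rewrite 3!toKM 2!toKC -cE -dE -eE !fracCM.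
  by move: (frac c)%:MP (frac d)%:MP (frac e)%:MP => x y z; ring.
have /eqP := congr1 spec E; rewrite !specM sf mulr0 specC !mulf_eq0.
rewrite (negPf (spec0_neq0 e0)) /= => /orP[]/eqP s0; [left; exists c, g|right; exists d, h] => //.
Qed.

(** Ideals are boolean predicates, so membership is decided classically. *)
Let S p : bool :=
  if ClassicalEpsilon.excluded_middle_informative (P p) then true else false.

Let SP p : reflect (P p) (S p).
Proof. by rewrite /S; case: ClassicalEpsilon.excluded_middle_informative => ?; constructor. Qed.

Lemma generic_fibre_prime : exists Q : prime_idealr {mpoly K[r]},
  forall p, p \in Q <-> ideal_gen (fun g => exists i, g = fibre_gen i) p.
Proof.
have S_ideal : idealr_closed S.
  split=> [||b u v]; rewrite /in_mem/=; first exact/SP.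
    by apply/SP => /P_J.
  by move=> /SP Pu /SP Pv; apply/SP/P_comb.
have S_prime : prime_idealr_closed S.
  by move=> u v /SP/P_prime[] /SP H; apply/orP; [left|right].
have [Q QE] := prime_idealr_of_closed S_ideal S_prime.
by exists Q => p; rewrite QE; split=> [/SP/P_J|/J_P/SP].
Qed.

End GenericFibre.

(* The ideal of the generic fibre of the map [A^r -> A^N] with components
   [a i], over the field of rational functions in the target coordinates. *)
Lemma generic_fibre_prime_exists (k : fieldType) (r N : nat) (a : 'I_N -> {mpoly k[r]}) :
  exists (K : fieldType) (iota : {rmorphism k -> K}) (c : 'I_N -> K),
  let J := ideal_gen (fun g => exists i, g = map_mpoly iota (a i) - (c i)%:MP) in
  ~ J 1 -> exists Q : prime_idealr {mpoly K[r]}, forall p, p \in Q <-> J p.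
Proof.
pose frac : {rmorphism {mpoly k[N]} -> {fraction {mpoly k[N]}}} := @FracField.tofrac _.
pose const : {rmorphism k -> {mpoly k[N]}} := @mpolyC N k.
pose spec0 : {rmorphism {mpoly k[N]} -> {mpoly k[r]}} := mmap (@mpolyC r k) a.
exists {fraction {mpoly k[N]}}, (frac \o const), (fun i => frac 'X_i).
apply: (@generic_fibre_prime k r N a _ _ frac const (fun i => 'X_i) spec0).
- by move=> p q /eqP; rewrite tofrac_eq => /eqP.
- exact: frac_denominator.
- by move=> Q; apply: mpoly_ring_ind.
- by move=> c; rewrite /spec0 /= mmapC.
- by move=> i; rewrite /spec0 /= mmapX mmap1U.
Qed.

(** * The prime ideal attached to a clique tree *)

Lemma clique_tree_prime (k : fieldType) (r n d : nat) (C : nat -> {set 'I_r}) (par : nat -> nat) :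
  (0 < n)%N ->
  (forall j, (par j <= j)%N) ->
  (forall j, (0 < j <= n)%N -> (par j < j)%N) ->
  (forall i j, (i < j <= n)%N -> C i :&: C j \subset C (par j)) ->
  (forall j, (j <= n)%N -> #|~: C j| = d) ->
  (forall i j, (i <= n)%N -> (j <= n)%N -> C i \subset C j -> i = j) ->
  (forall v, exists2 j, (j <= n)%N & v \in C j) ->
  exists (K : fieldType) (iota : {rmorphism k -> K}) (Q : prime_idealr {mpoly K[r]}),
    (forall p m, p \in Q -> p@_m != 0 -> (msize p <= (mdeg m).+1)%N ->
       exists2 j, (j <= n)%N & (sqfree_mon (~: C j) <= m)%MM) /\
    (forall j, (j <= n)%N -> exists2 p, p \in Q & leading_mon d (sqfree_mon (~: C j)) p).
Proof.
move=> n0 par_le par_lt par_inter C_card C_anti C_cover.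
(* The recursion is linear: its solution with initial values [f0], [f1] is
   [hP j * f0 + hQ j * f1]. *)
have [hP [P0 P1 Prec]] := syzygy_rec_exists C (1 : {mpoly k[r]}) 0 par_le.
have [hQ [Q0 Q1 Qrec]] := syzygy_rec_exists C (0 : {mpoly k[r]}) 1 par_le.
(* With [f0 = Q - t0] and [f1 = - P - t1] the products of [P] and [Q] cancel in [P * f0 + Q * f1],
   which becomes [- t1 * f0 + t0 * f1]; this closes the recursion. *)
pose a (i : 'I_2) := if i == ord0 then hQ n.+1 else - hP n.+1.
have [K [iota [c]]] := generic_fibre_prime_exists a.
set J := ideal_gen _ => primeJ; exists K, iota.
have Qlead := syzygy_rec_leading par_lt par_inter C_card C_anti C_cover Qrec Q0 Q1.
have Psize : (msize (hP n.+1) <= d.+1)%N.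
  by apply: (syzygy_rec_msize_last par_lt par_inter C_card C_cover Prec);
    rewrite ?P0 ?P1 ?msize0 ?msize1.
have d0 := d_gt0 par_lt par_inter C_card C_anti C_cover n0.
pose M (p : {mpoly k[r]}) : {mpoly K[r]} := map_mpoly iota p.
have Mcoef p m : (M p)@_m = iota p@_m by exact: mcoeff_map_mpoly.
have MM : {morph M : p q / p * q} by move=> p q; rewrite /M rmorphM.
have MB : {morph M : p q / p - q} by move=> p q; rewrite /M rmorphB.
have MN : {morph M : p / - p} by move=> p; rewrite /M rmorphN.
have MX m : M 'X_[m] = 'X_[m] by exact: map_mpolyX.
have M0 : M 0 = 0 by rewrite /M rmorph0.
have M1 : M 1 = 1 by rewrite /M rmorph1.
have Msize e p : (msize p <= e)%N -> (msize (M p) <= e)%N.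
  move/msize_ltP => pe; apply/msize_ltP => m /pe; rewrite Mcoef => ->.
  by rewrite rmorph0.
pose t0 := c ord0; pose t1 := c ord_max.
pose f0 := M (hQ n.+1) - t0%:MP; pose f1 := M (- hP n.+1) - t1%:MP.
pose f j := M (hP j) * f0 + M (hQ j) * f1.
have fE0 : f 0%N = f0 by rewrite /f P0 Q0 M0 M1 mul1r mul0r addr0.
have fE1 : f 1%N = f1 by rewrite /f P1 Q1 M0 M1 mul1r mul0r add0r.
have frec : syzygy_rec C par f.
  move=> j j0; rewrite /f Prec// Qrec// 2!MB 4!MM 2!MX.
  by move: (M (hP j)) (M (hP _)) (M (hQ j)) (M (hQ _)) => x y z w; ring.
have flast : f n.+1 = - t1 *: f 0%N + t0 *: f 1%N.
  rewrite fE0 fE1 /f /f0 /f1 MN -!mul_mpolyC mpolyCN.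
  by move: (M _) (M _) (t0%:MP) (t1%:MP) => x y z w; ring.
have C0 m (x : K) : (0 < mdeg m)%N -> (x%:MP_[r])@_m = 0.
  by rewrite mcoeffC; case: eqP => [->|_]; rewrite ?mdeg0// mulr0.
have constP e (p : {mpoly K[r]}) (x : K) : (0 < e)%N -> (msize p <= e)%N -> (msize (p - x%:MP) <= e)%N.
  move=> e0 /msize_ltP pe; apply/msize_ltP => m em.
  by rewrite mcoeffB pe// C0 ?subrr// (leq_trans e0).
have f0lead : leading_mon d (sqfree_mon (~: C 0%N)) (f 0%N).
  have [Qs Qtop] := Qlead; rewrite fE0; split; first by apply: constP; rewrite ?Msize.
  by move=> m md; rewrite mcoeffB C0 ?md// subr0 Mcoef Qtop// rmorph_nat.
have f1size : (msize (f 1%N) <= d.+1)%N.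
  by rewrite fE1; apply: constP => //; apply: Msize; rewrite msizeN.
have JE p : J p -> exists u v, p = u * f 0%N + v * f 1%N.
  elim/ideal_gen_ind => [|x y [u [v ->]] [u' [v' ->]]|b x [i ->]].
  - by exists 0, 0; rewrite !mul0r addr0.
  - by exists (u + u'), (v + v'); rewrite !mulrDl addrACA.
  - rewrite fE0 fE1 /a; case: (unliftP ord0 i) => [i' ->|->] /=.
      rewrite (ord1 i') (_ : lift ord0 ord0 = ord_max); last exact: val_inj.
      by exists 0, b; rewrite mul0r add0r.
    by exists b, 0; rewrite mul0r addr0.
have top := lifted_top_monomials par_lt par_inter C_card C_anti C_cover n0 frec flast f0lead f1size.
(* The only monomial of 1 has degree 0, while each [g j] has degree [d > 0]. *)
have J1 : ~ J 1.
  move=> /JE[u [v E]]; have [||j jn] := top u v 0%MM; rewrite -?E ?msize1//.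
    by rewrite mcoeff1 eqxx oner_neq0.
  rewrite sqfree_mon_le => /subset_leq_card; rewrite C_card// leqNgt.
  suff -> : mon_supp (0%MM : 'X_{1..r}) = set0 by rewrite cards0 d0.
  by apply/setP => v'; rewrite !inE mnm0E.
have {primeJ} [Q QE] := primeJ J1; exists Q; split=> [p m /QE/JE[u [v ->]]|j jn].
  exact: top.
exists (f j); last exact: (lifted_leading par_lt par_inter C_card C_anti C_cover n0 frec flast f0lead f1size jn).
have f0Q : f0 \in Q by apply/QE/ideal_gen_mem; exists ord0.
have f1Q : f1 \in Q by apply/QE/ideal_gen_mem; exists ord_max.
by apply: rpredD; apply: idealMr.
Qed.

(** * Comparison of the initial ideal with the monomial ideal *)

Lemma monomial_gen_msupp (k : fieldType) r (B : 'X_{1..r} -> Prop) (f : {mpoly k[r]}) :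
  ideal_gen (fun g => exists2 m, B m & g = 'X_[m]) f ->
  forall m, m \in msupp f -> exists2 m', B m' & (m' <= m)%MM.
Proof.
elim/ideal_gen_ind => [|f1 f2 IH1 IH2|a _ [b Bb ->]] m; first by rewrite msupp0.
  by move/msuppD_le; rewrite mem_cat => /orP[/IH1|/IH2].
move=> /msuppM_le/allpairsP[[m1 m2]/= []]; rewrite msuppX inE => _ /eqP-> ->.
by exists b => //; rewrite lem_addl.
Qed.

Theorem mainTheorem2 (k : fieldType) (r : nat) (ge : rel 'X_{1..r})
    (ge_order : monomial_order ge) (ge_degree : respects_degree ge)
    (I : idealr {mpoly k[r]})
    (I_sqfree : squarefree_monomial_ideal I)
    (I_codim : codim I 2)
    (I_CM : cohen_macaulay {ideal_quot I})
    (I_equigen : equigenerated I) :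
  exists (K : fieldType) (iota : {rmorphism k -> K})
         (P : prime_idealr {mpoly K[r]}),
    forall f : {mpoly K[r]}, initial_ideal ge P f <-> extended_ideal iota I f.
Proof.
have [F1 [a [b [ab nab]]]] := codim2_nonface I_sqfree I_codim.
have F_bounds (W : {set 'I_r}) u v q (z : {set 'I_r} -> k) :
    u \in W -> v \in W -> u != v -> ~~ face I [set u; v] -> (2 <= q)%N ->
    (forall t, z t != 0 -> [/\ t \subset W, face I t & #|t| = q]) ->
    (forall s : {set 'I_r}, #|s|.+1 = q -> koszul (fun=> 1) z s = 0) ->
    exists2 c : {set 'I_r} -> k,
      (forall t, c t != 0 -> [/\ t \subset W, face I t & #|t| = q.+1]) &
      (forall s : {set 'I_r}, #|s| = q -> z s = koszul (fun=> 1) c s).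
  (* Bounding a cycle on sets of size [q] uses Koszul acyclicity in degree [q.+1], which is at least
     3. *)
  move=> uW vW uv nuv q2; apply: (face_cycle_bounds I_sqfree _ uW).
  move=> f fI; apply: (cohen_macaulay_koszul_acyclic I_sqfree uW vW uv nuv I_CM) => //.
  by move=> t [] /fI.
have [Cs [Cs0 CW Cmax Canti Crip]] := clique_tree_exists (@face_subset k r I) F1 F_bounds setT ab nab.
pose C := nth set0 Cs; pose n := (size Cs).-1.
have sE j : (j < size Cs)%N = (j <= n)%N by rewrite -[in RHS]ltnS /n prednK.
have C_cover v : exists2 j, (j <= n)%N & v \in C j.
  have [j jn vC] := Cmax _ (subsetT _) (F1 v); exists j; rewrite -?sE//.
  by rewrite -sub1set.
(* A single clique would contain both [a] and [b]. *)
have n0 : (0 < n)%N.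
  rewrite lt0n; apply: contra nab => /eqP nE.
  have [i + ai] := C_cover a; have [j + bj] := C_cover b; rewrite nE !leqn0 => /eqP j0 /eqP i0.
  apply: face_subset (CW 0%N Cs0).2.
  by rewrite subUset !sub1set -/(C 0%N) -{1}i0 ai -j0 bj.
(* Finding the parent by search gives a total function with [par j <= j] everywhere. *)
pose P j p := all (fun i => C i :&: C j \subset C p) (iota 0 j).
pose par j := find (P j) (iota 0 j).
have par_le j : (par j <= j)%N by rewrite -[leqRHS](size_iota 0) find_size.
have par_has j : (0 < j <= n)%N -> has (P j) (iota 0 j).
  rewrite -sE => /Crip[p pj pP]; apply/hasP; exists p; first by rewrite mem_iota.
  by apply/allP => i; rewrite mem_iota => /andP[_ ij]; apply: pP.
have par_lt j : (0 < j <= n)%N -> (par j < j)%N.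
  by move/par_has; rewrite has_find size_iota.
have par_inter i j : (i < j <= n)%N -> C i :&: C j \subset C (par j).
  move=> /andP[ij jn]; have jn' : (0 < j <= n)%N by rewrite jn andbT (leq_ltn_trans _ ij).
  have := nth_find 0%N (par_has _ jn'); rewrite nth_iota -/(par j) ?par_lt//.
  by move/allP; apply; rewrite mem_iota.
have C_anti i j : (i <= n)%N -> (j <= n)%N -> C i \subset C j -> i = j.
  by rewrite -!sE; apply: Canti.
have memI m : ('X_[m] \in I) <-> exists2 j, (j <= n)%N & (sqfree_mon (~: C j) <= m)%MM.
  rewrite memX_ideal//; split=> [/(Cmax _ (subsetT _))[j js mC]|[j jn gm]].
    by exists j; rewrite -?sE// sqfree_mon_le -setCS setCK.
  have /CW[_] : (j < size Cs)%N by rewrite sE.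
  by apply: face_subset; rewrite -setCS setCK -sqfree_mon_le.
(* The [g j] are minimal generators because no clique contains another, so equigeneration gives them
   a common degree. *)
have [d C_card] : exists d, forall j, (j <= n)%N -> #|~: C j| = d.
  have [d dP] := I_equigen; exists d => j jn; rewrite -mdeg_sqfree_mon.
  apply: (dP (fun m => exists2 j, (j <= n)%N & m = sqfree_mon (~: C j))); last by exists j.
  split=> [f|B' B'B gB' _ [i iN ->]].
    split=> [/(mem_monomial_ideal I_sqfree) fI|].
      rewrite [f]mpolyE big_seq; apply: ideal_gen_sum => m /fI.
      rewrite -memX_ideal// => /memI[i iN gm].
      rewrite -(submK gm) mpolyXD scalerAl; apply/ideal_genM/ideal_gen_mem.
      by exists (sqfree_mon (~: C i)) => //; exists i.
    elim/ideal_gen_ind => [|f1 f2|u _ [_ [i iN ->] ->]]; first exact: idealr0.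
      exact: rpredD.
    by apply/idealMr/memI; exists i; rewrite ?lepm_refl.
  have /gB'/monomial_gen_msupp : 'X_[sqfree_mon (~: C i)] \in I.
    by apply/memI; exists i; rewrite ?lepm_refl.
  move=> /(_ (sqfree_mon (~: C i))); rewrite msuppX inE => /(_ (eqxx _))[m' B'm'].
  have [l ln m'E] := B'B _ B'm'; move: B'm'; rewrite m'E => B'l.
  by rewrite sqfree_mon_le mon_suppK setCS => /C_anti-> .
have [K [iota [Q [Qtop Qlead]]]] :=
  clique_tree_prime k n0 par_le par_lt par_inter C_card C_anti C_cover.
have [ge_total ge_anti _ _ _] := ge_order.
exists K, iota, Q => f; split.
  elim/ideal_gen_ind => [|x y|u _ [p [pQ p0 [m [mp mmax ->]]]]].
  - exact: ideal_gen0.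
  - exact: ideal_genD.
  (* The order respects degree, so the initial monomial of [p] has top degree. *)
  have psz : (msize p <= (mdeg m).+1)%N.
    rewrite -mlead_deg// ltnS leqNgt; apply/negP => /ge_degree/andP[gml].
    by rewrite (ge_anti (mlead p) m) ?eqxx// gml mmax// mlead_supp.
  rewrite mcoeff_msupp in mp; have [j jn gm] := Qtop p m pQ mp psz.
  rewrite -(submK gm) mpolyXD scalerAl; apply/ideal_genM/ideal_genM/ideal_gen_mem.
  exists 'X_[sqfree_mon (~: C j)]; last by rewrite map_mpolyX.
  by apply/memI; exists j; rewrite ?lepm_refl.
elim/ideal_gen_ind => [|x y|u _ [p pI ->]]; first exact: ideal_gen0.
  exact: ideal_genD.
apply: ideal_genM; rewrite [p]mpolyE raddf_sum big_seq; apply: ideal_gen_sum => m.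
move/(mem_monomial_ideal I_sqfree): pI => /[apply].
rewrite -memX_ideal// => /memI[j jn gm].
rewrite /= map_mpolyZ map_mpolyX -(submK gm) mpolyXD scalerAl; apply/ideal_genM/ideal_gen_mem.
(* The top form of [q] is a single monomial, which is therefore the initial term for every order
   respecting degree. *)
have [q qQ [qsz qtop]] := Qlead j jn.
have gd : mdeg (sqfree_mon (~: C j)) = d by rewrite mdeg_sqfree_mon C_card.
have q1 : q@_(sqfree_mon (~: C j)) = 1 by rewrite qtop// eqxx.
exists q; split=> //.
  by apply: contra_eq_neq q1 => ->; rewrite mcoeff0 eq_sym oner_neq0.
exists (sqfree_mon (~: C j)); split=> [|m'|]; last by rewrite q1 scale1r.
  by rewrite mcoeff_msupp q1 oner_neq0.
move=> m'q; have := msize_mdeg_lt m'q => /leq_trans/(_ qsz); rewrite ltnS leq_eqVlt.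
case/orP => [/eqP m'd|m'd]; last first.
  by have := @ge_degree (sqfree_mon (~: C j)) m'; rewrite gd => /(_ m'd)/andP[].
move: m'q; rewrite mcoeff_msupp qtop//; case: (m' =P _) => [->|_]; last by rewrite eqxx.
by move=> _; have := ge_total (sqfree_mon (~: C j)) (sqfree_mon (~: C j)); rewrite orbb.
Qed.
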